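(* Let $N\subseteq M$ be an irreducible inclusion of $\mathrm{II}_1$ factors (that is, $N'\cap M=\mathbb{C}1$). Then: (i) Each non-zero projection $f\in N'\cap\langle M,e_N\rangle$ satisfying $\mathrm{Tr}(f)\le 1$ has the form $f=u^*e_Nu$ for some unitary $u\in M$ with $uNu^*\subseteq N$. (ii) Each non-zero projection $f\in N'\cap\langle M,e_N\rangle$ satisfies $\mathrm{Tr}(f)\ge 1$.
   Context: $\mathrm{II}_1$ factors are assumed separable. The index $[M:N]$ is not assumed finite. Let $\tau$ be the unique normalized faithful normal trace on $M$. $M$ acts by left multiplication on $L^2(M)=L^2(M,\tau)$, and $e_N$ is the orthogonal projection of $L^2(M)$ onto the closed subspace $L^2(N)$. The basic construction $\langle M,e_N\rangle$ is the von Neumann algebra on $L^2(M)$ generated by $M$ and $e_N$. $\mathrm{Tr}$ denotes the unique faithful semifinite normal trace on $\langle M,e_N\rangle$ with $\mathrm{Tr}(e_N)=1$. Commutants are taken in $B(L^2(M))$. *)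

(* Defs.v *)
From HB Require Import structures.
From mathcomp Require Import all_boot all_order all_algebra.
From mathcomp Require Import sesquilinear.
From mathcomp Require Import all_classical all_reals all_analysis.
From mathcomp.real_closed Require Export complex.
Set Implicit Arguments.
Unset Strict Implicit.
Unset Printing Implicit Defensive.
Import Order.TTheory GRing.Theory Num.Theory numFieldNormedType.Exports.
Local Open Scope classical_set_scope.
Local Open Scope ring_scope.

(* A complex Hilbert space is a completeNormedModType H over R[i] with a form
   dot : {dot H for Num.conj} (linear in its first argument) such that
   dot x x = `|x| ^+ 2.  Operators are plain functions H -> H; boundedness is a
   predicate, and von Neumann algebras are sets of bounded operators. *)
Section OperatorAlgebras.
Context {R : realType} {H : completeNormedModType R[i]}.
Variable dot : {dot H for Num.conj}.
Implicit Types (a b e f u : H -> H) (A S D : set (H -> H)).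

Definition bounded_op a : Prop := linear a /\ continuous a.

(* By Riesz representation the adjoint of a bounded operator exists; it is
   unique as dot is definite. *)
Definition adj a : H -> H :=
  get [set b | forall x y, dot (a x) y = dot x (b y)].

Definition projection_op f : Prop :=
  [/\ bounded_op f, adj f = f & f \o f = f].

Definition unitary_op u : Prop :=
  [/\ bounded_op u, adj u \o u = idfun & u \o adj u = idfun].

Definition orth_proj (V : set H) : H -> H :=
  get [set e | forall x, V (e x) /\ forall y, V y -> dot (x - e x) y = 0].

Definition commutant S : set (H -> H) :=
  [set a | bounded_op a /\ forall s, S s -> a \o s = s \o a].

(* The bicommutant condition forces A to be a unital algebra of bounded
   operators. *)
Definition von_neumann A : Prop :=
  (forall a, A a -> A (adj a)) /\ commutant (commutant A) = A.

Definition vN_generated S : set (H -> H) := smallest von_neumann S.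

Definition scalars : set (H -> H) :=
  [set a | exists c : R[i], a = fun x => c *: x].

Definition is_factor A : Prop :=
  von_neumann A /\ A `&` commutant A = scalars.

Definition infinite_dimensional A : Prop :=
  forall (n : nat) (b : 'I_n -> H -> H), exists2 a, A a &
    forall c : 'I_n -> R[i], a <> fun x => \sum_(i < n) c i *: b i x.

(* In R[i], z <= w means that w - z is real and nonnegative. *)
Definition op_le a b : Prop := forall x, dot (a x) x <= dot (b x) x.

Definition pos_cone A : set (H -> H) := [set a | A a /\ op_le (fun=> 0) a].

Definition directed D : Prop :=
  D !=set0 /\
  forall a b, D a -> D b -> exists c, [/\ D c, op_le a c & op_le b c].

Definition is_sup_in A D a : Prop :=
  [/\ pos_cone A a, forall d, D d -> op_le d a &
      forall b, pos_cone A b -> (forall d, D d -> op_le d b) -> op_le a b].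

Definition is_normal A (w : (H -> H) -> \bar R) : Prop :=
  forall D a, D `<=` pos_cone A -> directed D -> is_sup_in A D a ->
    w a = ereal_sup (w @` D).

(* Only the values of Tr on the positive cone of A are constrained. *)
Record is_fns_trace A (Tr : (H -> H) -> \bar R) : Prop := {
  fns_ge0 : forall a, pos_cone A a -> (0 <= Tr a)%E ;
  fns_add : forall a b, pos_cone A a -> pos_cone A b ->
    Tr (a \+ b) = (Tr a + Tr b)%E ;
  fns_scale : forall (r : R) a, 0 <= r -> pos_cone A a ->
    Tr (fun x => r%:C%C *: a x) = (r%:E * Tr a)%E ;
  fns_tracial : forall a, A a -> Tr (adj a \o a) = Tr (a \o adj a) ;
  fns_faithful : forall a, pos_cone A a -> Tr a = 0%E -> a = fun=> 0 ;
  fns_normal : is_normal A Tr ;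
  fns_semifinite : forall a, pos_cone A a -> a <> (fun=> 0) ->
    exists b, [/\ pos_cone A b, op_le b a, b <> (fun=> 0) & (Tr b < +oo)%E]
}.

(* Normalized faithful normal trace; only the values on A are constrained. *)
Record is_tracial_state A (tau : (H -> H) -> R[i]) : Prop := {
  tau_linear : forall (c : R[i]) a b, A a -> A b ->
    tau (fun x => c *: a x + b x) = c * tau a + tau b ;
  tau_ge0 : forall a, pos_cone A a -> 0 <= tau a ;
  tau_normalized : tau idfun = 1 ;
  tau_tracial : forall a b, A a -> A b -> tau (a \o b) = tau (b \o a) ;
  tau_faithful : forall a, pos_cone A a -> tau a = 0 -> a = fun=> 0 ;
  tau_normal : is_normal A (fun a => (complex.Re (tau a))%:E)
}.

(* Separability for the norm `|a|_2 = (tau (a^* a))^(1/2). *)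
Definition separable_in_2norm A (tau : (H -> H) -> R[i]) : Prop :=
  exists D, [/\ countable D, D `<=` A &
    forall a (eps : R), A a -> 0 < eps ->
      exists2 d, D d & complex.Re (tau (adj (a \- d) \o (a \- d))) < eps ^+ 2].

Definition is_II1_factor A : Prop :=
  [/\ is_factor A, infinite_dimensional A &
      exists tau, is_tracial_state A tau /\ separable_in_2norm A tau].

Definition L2_subspace A (Omega : H) : set H :=
  closure [set a Omega | a in A].

(* H is L^2(A, tau), the completion of A for <a, b> = tau (b^* a), the image of
   a in A being a Omega; then A acts by left multiplication, as
   a (b Omega) = (a b) Omega. *)
Definition is_L2 A (tau : (H -> H) -> R[i]) (Omega : H) : Prop :=
  (forall a b, A a -> A b -> dot (a Omega) (b Omega) = tau (adj b \o a)) /\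
  L2_subspace A Omega = setT.

Definition jones_proj A (Omega : H) : H -> H :=
  orth_proj (L2_subspace A Omega).

Definition basic_construction A e : set (H -> H) :=
  vN_generated (A `|` [set e]).

End OperatorAlgebras.

(* Main.v *)
(* Write e for the Jones projection, A for the basic construction and r_n for the
   right multiplication a Omega |-> a n Omega by n in N; A commutes with all r_n.
   Irreducibility makes A a factor, so Tr f <= Tr e provides v in A with
   v^* v = f and v v^* <= e.  Put xi = v^* Omega.  Since f commutes with N and
   e A e carries the trace <X Omega, Omega>, the vector state a |-> <a xi, xi>
   of M is centralized by N.  Averaging over the unitary group of N shows that it
   is a multiple of tau, because the averages of a converge to tau(a) 1 by
   irreducibility.  Hence xi = L Omega where L in M is a multiple of a unitary,
   v^* = L e, and f = L e L^* with L unitary.  This is (i), and (ii) follows: a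
   projection with Tr f < 1 would be u^* e u, which has trace Tr e = 1. *)
Require Import Defs.
From HB Require Import structures.
From mathcomp Require Import all_boot all_order all_algebra.
From mathcomp Require Import sesquilinear.
From mathcomp Require Import all_classical all_reals all_analysis.
From mathcomp Require Import ring lra.
Set Implicit Arguments.
Unset Strict Implicit.
Unset Printing Implicit Defensive.
Import Order.TTheory GRing.Theory Num.Theory numFieldNormedType.Exports.
Local Open Scope classical_set_scope.
Local Open Scope ring_scope.

(** * Hilbert spaces *)
Section HilbertSpace.
Context (R : realType) (H : completeNormedModType R[i]).
Context (dot : {dot H for Num.conj}).
Context (dot_norm : forall x : H, dot x x = `|x| ^+ 2).
Implicit Types (x y z : H) (c : R[i]).

(** The trace on e A e is inherited from N by approximation. Suppose X commutes with the r_n, n in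
    N, and X Omega, X^* Omega lie in the closure of N Omega. If x in N brings x Omega close to X
    Omega, then x^* Omega is just as close to X^* Omega, so the trace identity of N passes to two
    such operators. It is applied to X = v a v^* and Y = v n v^*. Since v^* v = f commutes with n,
    one gets X Y = v a n v^* and Y X = v n a v^*, which is the centrality of the vector state of xi.

    In the comparison step a maximal partial isometry exhausts e or f. If it exhausts e, then Tr
    (v^* v) = Tr e = 1 is finite and at least Tr f, so the remainder f - v^* v has trace 0 and
    vanishes by faithfulness.

    The multiple of tau fixes L L^* = c, a norm computation gives L^* L = c, and f^2 = f forces c =
    1. *)

Lemma ReJ (z : R[i]) : complex.Re (Num.conj z) = complex.Re z.
Proof. by case: z. Qed.

Lemma ReD (z w : R[i]) : complex.Re (z + w) = complex.Re z + complex.Re w.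
Proof. by case: z; case: w. Qed.

Lemma ReN (z : R[i]) : complex.Re (- z) = - complex.Re z.
Proof. by case: z. Qed.

Lemma ReZ (r : R) (z : R[i]) : complex.Re (r%:C%C * z) = r * complex.Re z.
Proof. by case: z => a b /=; rewrite mul0r subr0. Qed.

Lemma ReI (z : R[i]) : complex.Re ('i%C * z) = - complex.Im z.
Proof. by case: z => a b /=; rewrite mul0r mul1r sub0r. Qed.

Lemma conjR (r : R) : Num.conj (r%:C%C : R[i]) = r%:C%C.
Proof. by apply/eqP; rewrite eq_complex /= oppr0 !eqxx. Qed.

Lemma complexP (z w : R[i]) : complex.Re z = complex.Re w ->
  complex.Im z = complex.Im w -> z = w.
Proof. by case: z; case: w => a b c d /= -> ->. Qed.

Lemma complex_gt0 (e : R[i]) : 0 < e -> 0 < complex.Re e /\ e = (complex.Re e)%:C%C.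
Proof. by case: e => a b; rewrite ltcE /= => /andP[/eqP -> ->]. Qed.

Lemma dotDl x y z : dot (x + y) z = dot x z + dot y z.
Proof. exact: linearDl. Qed.

Lemma dotDr x y z : dot z (x + y) = dot z x + dot z y.
Proof. exact: linearDr. Qed.

Lemma dotZl c x z : dot (c *: x) z = c * dot x z.
Proof. exact: linearZl_LR. Qed.

Lemma dotZr c x z : dot z (c *: x) = Num.conj c * dot z x.
Proof. exact: linearZr_LR. Qed.

Lemma dotNl x z : dot (- x) z = - dot x z.
Proof. exact: linearNl. Qed.

Lemma dotNr x z : dot z (- x) = - dot z x.
Proof. exact: linearNr. Qed.

Lemma dotBl x y z : dot (x - y) z = dot x z - dot y z.
Proof. by rewrite dotDl dotNl. Qed.

Lemma dotBr x y z : dot z (x - y) = dot z x - dot z y.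
Proof. by rewrite dotDr dotNr. Qed.

Lemma dot0l z : dot 0 z = 0.
Proof. exact: linear0l. Qed.

Lemma dot0r z : dot z 0 = 0.
Proof. exact: linear0r. Qed.

Lemma dotC x y : dot x y = Num.conj (dot y x).
Proof. by rewrite hermC /= expr0 mul1r. Qed.

(** The order of [R[i]] is partial, so estimates are made with the underlying real inner product and
    the real-valued norm [nm]. Complex identities are recovered by testing multiples by 1 and
    ['i]. *)
Definition real_dot x y : R := complex.Re (dot x y).
Definition nm x : R := complex.Re `|x|.

Lemma nmE x : `|x| = (nm x)%:C%C.
Proof.
by rewrite /nm; have := normr_ge0 x; case: `|x| => a b; rewrite lecE /= => /andP[/eqP ->].
Qed.

Lemma nm_ge0 x : 0 <= nm x.
Proof. by have := normr_ge0 x; rewrite nmE lecR. Qed.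

Lemma dotxx x : dot x x = (nm x ^+ 2)%:C%C.
Proof. by rewrite dot_norm nmE rmorphXn. Qed.

Lemma rdotxx x : real_dot x x = nm x ^+ 2.
Proof. by rewrite /real_dot dotxx. Qed.

Lemma rdotC x y : real_dot x y = real_dot y x.
Proof. by rewrite /real_dot dotC ReJ. Qed.

Lemma rdotDl x y z : real_dot (x + y) z = real_dot x z + real_dot y z.
Proof. by rewrite /real_dot dotDl ReD. Qed.

Lemma rdotDr x y z : real_dot z (x + y) = real_dot z x + real_dot z y.
Proof. by rewrite /real_dot dotDr ReD. Qed.

Lemma rdotNl x z : real_dot (- x) z = - real_dot x z.
Proof. by rewrite /real_dot dotNl ReN. Qed.

Lemma rdotNr x z : real_dot z (- x) = - real_dot z x.
Proof. by rewrite /real_dot dotNr ReN. Qed.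

Lemma rdotZl (r : R) x z : real_dot (r%:C%C *: x) z = r * real_dot x z.
Proof. by rewrite /real_dot dotZl ReZ. Qed.

Lemma rdotZr (r : R) x z : real_dot z (r%:C%C *: x) = r * real_dot z x.
Proof. by rewrite rdotC rdotZl rdotC. Qed.

Definition rdotE :=
  (rdotDl, rdotDr, rdotNl, rdotNr, rdotZl, rdotZr).

Lemma nmD x y : nm (x + y) <= nm x + nm y.
Proof. by have := ler_normD x y; rewrite !nmE -rmorphD lecR. Qed.

Lemma nmN x : nm (- x) = nm x.
Proof. by rewrite /nm normrN. Qed.

Lemma nmB x y : nm (x - y) = nm (y - x).
Proof. by rewrite -opprB nmN. Qed.

Lemma nm0 : nm 0 = 0.
Proof. by rewrite /nm normr0. Qed.

Lemma nm_eq0 x : nm x = 0 -> x = 0.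
Proof. by move=> x0; apply/normr0_eq0; rewrite nmE x0. Qed.

Lemma nm_gt0 x : x <> 0 -> 0 < nm x.
Proof. by move=> x0; rewrite lt_neqAle nm_ge0 andbT eq_sym; apply/eqP => /nm_eq0. Qed.

Lemma nmZ c x : nm (c *: x) = complex.Re `|c| * nm x.
Proof.
rewrite /nm normrZ; have := normr_ge0 c.
by case: `|c| => a b; rewrite lecE /= => /andP[/eqP -> _]; rewrite -ReZ.
Qed.

Lemma nm_tri x y z : nm (x - z) <= nm (x - y) + nm (y - z).
Proof. by rewrite -[x - z](subrKA y) nmD. Qed.

Lemma parallelogram x y :
  nm (x + y) ^+ 2 + nm (x - y) ^+ 2 = 2 * nm x ^+ 2 + 2 * nm y ^+ 2.
Proof. by rewrite -!rdotxx !rdotE; ring. Qed.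

Lemma nm_add_sq x y : nm (x + y) ^+ 2 = nm x ^+ 2 + 2 * real_dot x y + nm y ^+ 2.
Proof. by rewrite -!rdotxx !rdotE (rdotC y x); ring. Qed.

Lemma nm_le_sq x (r : R) : 0 <= r -> nm x ^+ 2 <= r ^+ 2 -> nm x <= r.
Proof. by move=> r0; rewrite ler_sqr ?nnegrE ?nm_ge0. Qed.

Lemma cauchy_schwarz x y : real_dot x y <= nm x * nm y.
Proof.
have [->|y0] := pselect (y = 0); first by rewrite /real_dot dot0r nm0 mulr0.
have [->|x0] := pselect (x = 0); first by rewrite /real_dot dot0l nm0 mul0r.
have py := nm_gt0 y0; have px := nm_gt0 x0.
have := sqr_ge0 (nm ((nm y)%:C%C *: x - (nm x)%:C%C *: y)).
rewrite -rdotxx !rdotE !rdotxx (rdotC y x) => h.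
rewrite -(ler_pM2l (mulr_gt0 px py)) -subr_ge0 -(pmulr_rge0 _ (ltr0n R 2)).
by apply: le_trans h _; rewrite le_eqVlt; apply/orP; left; apply/eqP; ring.
Qed.

Lemma rdot_abs x y : `|real_dot x y| <= nm x * nm y.
Proof.
rewrite ler_norml cauchy_schwarz andbT lerNl.
by rewrite -rdotNl -(nmN x) cauchy_schwarz.
Qed.

Lemma ball_nm x y (e : R) : ball x (e%:C%C : R[i]) y = (nm (x - y) < e) :> Prop.
Proof. by rewrite -ball_normE /= nmE ltcR. Qed.

Lemma closure_nm (V : set H) x :
  closure V x <-> forall e : R, 0 < e -> exists2 y, V y & nm (x - y) < e.
Proof.
split=> [Vx e e0|Vx].
  have e0' : 0 < (e%:C%C : R[i]) by rewrite ltcR.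
  have [y [Vy]] := Vx _ (nbhsx_ballx x _ e0').
  by rewrite ball_nm; exists y.
move=> B /nbhs_ballP[e /= e0 Be]; have [re0 eE] := complex_gt0 e0.
have [y Vy xy] := Vx _ re0; exists y; split=> //.
by apply: Be; rewrite eE ball_nm.
Qed.

(** Completeness without sequences: the sets [P e] form a filter base with diameters shrinking to 0.
    With [P e y] read as [y] being an approximation of quality [e], the limit comes with its rate of
    convergence. *)
Lemma complete_nested (P : R -> H -> Prop) :
  (forall e, 0 < e -> exists y, P e y) ->
  (forall e e' y, 0 < e -> e <= e' -> P e y -> P e' y) ->
  (forall e y z, 0 < e -> P e y -> P e z -> nm (y - z) <= e) ->
  exists l, forall e y, 0 < e -> P e y -> nm (y - l) <= e.
Proof.
move=> Pne Pmon Pd.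
pose F : set_system H := filter_from [set e : R | 0 < e] P.
have FF : ProperFilter F.
  apply: filter_from_proper; last by move=> e /Pne.
  apply: filter_from_filter; first by exists 1 => /=.
  move=> e e' /= e0 e'0; exists (Num.min e e'); first by rewrite /= lt_min e0.
  by move=> y Py; split; apply: (Pmon _ _ _ _ _ Py); rewrite ?lt_min ?e0 ?ge_min ?lexx ?orbT.
have : cauchy F.
  apply/cauchy_exP => e e0; have [re0 eE] := complex_gt0 e0.
  have e2 : 0 < complex.Re e / 2 by rewrite divr_gt0.
  have [y Py] := Pne _ e2; exists y; exists (complex.Re e / 2) => // z Pz.
  rewrite /= eE ball_nm (le_lt_trans (Pd _ _ _ e2 Py Pz)) //; lra.
move/cauchy_cvg => /cvg_ex[l Fl]; exists l => e y e0 Py.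
apply/ler_addgt0Pr => d d0.
have d0' : 0 < (d%:C%C : R[i]) by rewrite ltcR.
have [e' /= e'0 Pe'] := Fl _ (nbhsx_ballx l _ d0').
have m0 : 0 < Num.min e e' by rewrite lt_min e0.
have [z Pz] := Pne _ m0.
have /Pe' : P e' z by apply: (Pmon _ _ _ m0 _ Pz); rewrite ge_min lexx orbT.
rewrite ball_nm => lz.
have Pz' : P e z by apply: (Pmon _ _ _ m0 _ Pz); rewrite ge_min lexx.
by apply: le_trans (nm_tri y z l) _; rewrite lerD ?(Pd e) // nmB ltW.
Qed.

Lemma nm_bound_gt0 (a : H -> H) (C : R) : (forall x, nm (a x) <= C * nm x) ->
  exists2 D, 0 < D & forall x, nm (a x) <= D * nm x.
Proof.
move=> aC; exists (`|C| + 1); first by rewrite ltr_pwDr.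
move=> x; apply: le_trans (aC x) _; apply: ler_wpM2r; first exact: nm_ge0.
by rewrite (le_trans (ler_norm C)) // lerDl.
Qed.

Lemma bounded_opP (a : H -> H) :
  bounded_op a <-> linear a /\ exists C : R, forall x, nm (a x) <= C * nm x.
Proof.
split=> [[la ca]|[la [C aC]]]; split=> //.
  pose A : {linear H -> H} := HB.pack a (GRing.isLinear.Build _ _ _ _ a la).
  have /linear_bounded_continuous/linear_boundedP : continuous A by [].
  move=> [M [Mr HM]]; have rM : (M : R[i]) = (complex.Re M)%:C%C by rewrite RRe_real.
  exists (complex.Re M + 1) => x.
  have := HM ((complex.Re M + 1)%:C%C); rewrite {1}rM ltcR ltrDl ltr01.
  by move=> /(_ isT x); rewrite !nmE -rmorphM lecR.
have [D D0 aD] := nm_bound_gt0 aC.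
pose A : {linear H -> H} := HB.pack a (GRing.isLinear.Build _ _ _ _ a la).
suff : continuous A by [].
apply/linear_bounded_continuous/linear_boundedP.
exists (D%:C%C); split; first by apply/complex_realP; exists D.
move=> r Dr x; suff : `|a x| <= r * `|x| by [].
rewrite !nmE; apply: (@le_trans _ _ (D%:C%C * (nm x)%:C%C)).
  by rewrite -rmorphM lecR; exact: aD.
by apply: ler_wpM2r; [rewrite lecR nm_ge0 | exact: ltW].
Qed.

End HilbertSpace.

(** * Convexity, orthogonal projection, Riesz representation and extension of bounded maps *)

Section HilbertGeometry.
Context (R : realType) (H : completeNormedModType R[i]).
Context (dot : {dot H for Num.conj}).
Context (dot_norm : forall x : H, dot x x = `|x| ^+ 2).
Implicit Types (x y z : H) (c : R[i]) (V D : set H).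
Local Notation rdot := (real_dot dot).
Local Notation rdotE := (rdotE dot).
Local Notation rdotxx := (rdotxx dot_norm).

Definition subspace V := V 0 /\ forall c x y, V x -> V y -> V (c *: x + y).

Lemma half_add_half x : (2^-1)%:C%C *: x + (2^-1)%:C%C *: x = x.
Proof. by rewrite -scalerDl -rmorphD (_ : 2^-1 + 2^-1 = 1 :> R) ?scale1r //; lra. Qed.

(* The quantitative estimate makes near-minimizers close to the minimizer. *)
Lemma min_norm V : V !=set0 ->
  (forall x y, V x -> V y -> V ((2^-1)%:C%C *: (x + y))) ->
  exists2 l, closure V l &
    forall y, V y -> nm (y - l) ^+ 2 <= 4 * (nm y ^+ 2 - nm l ^+ 2).
Proof.
move=> [v0 Vv0] Vmid; pose Q := [set nm y ^+ 2 | y in V].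
have Q0 : has_inf Q.
  by split; [exists (nm v0 ^+ 2), v0 | exists 0 => _ [y _ <-]; rewrite sqr_ge0].
pose d := inf Q.
have dle y : V y -> d <= nm y ^+ 2 by move=> Vy; apply: (ge_inf Q0.2); exists y.
have d0 : 0 <= d by apply: lb_le_inf; [exact: Q0.1 | move=> _ [y _ <-]; exact: sqr_ge0].
have near e : 0 < e -> exists2 y, V y & nm y ^+ 2 < d + e.
  by move=> e0; have [_ [y Vy <-] h] := inf_adherent e0 Q0; exists y.
(* Midpoints stay in [V], so the parallelogram law gives |y - z|^2 <= 2 (|y|^2 - d) + 2 (|z|^2 - d).
   The factor 4 is the one that makes the diameter at most [e]. *)
pose P e y := V y /\ 4 * (nm y ^+ 2 - d) <= e ^+ 2.
have [] := @complete_nested _ _ P.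
- move=> e e0; have e4 : 0 < e ^+ 2 / 4 by rewrite divr_gt0 ?exprn_gt0.
  by have [y Vy hy] := near _ e4; exists y; split=> //; lra.
- move=> e e' y e0 ee' [Vy hy]; split=> //.
  by apply: le_trans hy _; rewrite ler_sqr ?nnegrE // ltW // (lt_le_trans e0).
- move=> e y z e0 [Vy hy] [Vz hz]; apply: nm_le_sq (ltW e0) _.
  have := parallelogram dot_norm y z; have := dle _ (Vmid _ _ Vy Vz).
  rewrite -!rdotxx !rdotE !rdotxx => h1 h2; nra.
move=> l Pl; have le2 y : V y -> nm (y - l) ^+ 2 <= 4 * (nm y ^+ 2 - d).
  move=> Vy; apply/ler_addgt0Pr => e e0.
  have k0 : 0 <= 4 * (nm y ^+ 2 - d) by rewrite mulr_ge0 // subr_ge0 dle.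
  have ke0 : 0 <= 4 * (nm y ^+ 2 - d) + e by rewrite addr_ge0 // ltW.
  rewrite -(sqr_sqrtr ke0) ler_sqr ?nnegrE ?nm_ge0 ?sqrtr_ge0 //.
  apply: Pl; first by rewrite sqrtr_gt0 ltr_wpDl.
  by split=> //; rewrite sqr_sqrtr // lerDl ltW.
have ld : nm l ^+ 2 <= d.
  rewrite -(sqr_sqrtr d0) ler_sqr ?nnegrE ?nm_ge0 ?sqrtr_ge0 //.
  apply/ler_addgt0Pr => e e0; have e4 : 0 < (e / 4) ^+ 2 by rewrite exprn_gt0 ?divr_gt0.
  have [y Vy hy] := near _ e4.
  have h1 : nm (y - l) <= e / 2.
    by apply: nm_le_sq; [lra | have := le2 _ Vy; lra].
  have h2 : nm y <= Num.sqrt d + e / 4.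
    apply: nm_le_sq; first by rewrite addr_ge0 ?sqrtr_ge0 ?ltW ?divr_gt0.
    rewrite sqrrD sqr_sqrtr //; apply: le_trans (ltW hy) _.
    have s0 := sqrtr_ge0 d; nra.
  have := nm_tri l y 0; rewrite !subr0 nmB => h3; lra.
exists l.
  apply/closure_nm => e e0; have e4 : 0 < (e / 4) ^+ 2 by rewrite exprn_gt0 ?divr_gt0.
  have [y Vy hy] := near _ e4; exists y => //; rewrite nmB.
  have h1 : nm (y - l) <= e / 2 by apply: nm_le_sq; [lra | have := le2 _ Vy; lra].
  lra.
by move=> y Vy; apply: le_trans (le2 _ Vy) _; rewrite ler_pM2l // lerB.
Qed.

Lemma subspaceD V x y : subspace V -> V x -> V y -> V (x + y).
Proof. by move=> [_ Vl] Vx Vy; rewrite -[x]scale1r; exact: Vl. Qed.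

Lemma subspaceZ V c x : subspace V -> V x -> V (c *: x).
Proof. by move=> [V0 Vl] Vx; rewrite -[_ *: _]addr0; exact: Vl. Qed.

Lemma subspaceN V x : subspace V -> V x -> V (- x).
Proof. by move=> Vs Vx; rewrite -scaleN1r; exact: subspaceZ. Qed.

Lemma subspaceB V x y : subspace V -> V x -> V y -> V (x - y).
Proof. by move=> Vs Vx Vy; apply: subspaceD => //; exact: subspaceN. Qed.

Lemma closure_subspace V : subspace V -> subspace (closure V).
Proof.
move=> Vs; split; first by apply: subset_closure; exact: Vs.1.
move=> c x y /closure_nm Vx /closure_nm Vy; apply/closure_nm => e e0.
have k0 : 0 <= complex.Re `|c| by have := normr_ge0 c; rewrite lecE => /andP[].
have k1 : 0 < complex.Re `|c| + 1 by lra.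
have [x' Vx' hx] := Vx (e / (2 * (complex.Re `|c| + 1))) (divr_gt0 e0 (mulr_gt0 (ltr0n _ 2) k1)).
have [y' Vy' hy] := Vy (e / 2) (divr_gt0 e0 (ltr0n _ 2)).
exists (c *: x' + y'); first exact: Vs.2.
have -> : c *: x + y - (c *: x' + y') = c *: (x - x') + (y - y').
  by rewrite scalerBr opprD addrACA.
apply: le_lt_trans (nmD _ _) _; rewrite nmZ.
have : complex.Re `|c| * nm (x - x') <= e / 2.
  apply: (@le_trans _ _ ((complex.Re `|c| + 1) * (e / (2 * (complex.Re `|c| + 1))))).
    by apply: ler_pM; rewrite ?nm_ge0 ?(ltW hx) // lerDl.
  rewrite le_eqVlt; apply/orP; left; apply/eqP; field; lra.
lra.
Qed.

Lemma closureK V x : closure (closure V) x -> closure V x.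
Proof. by move=> h; rewrite (closure_id (closure V)).1 //; exact: closed_closure. Qed.

Lemma rdot_zero (b c : R) : 0 <= c -> (forall t : R, 0 <= 2 * t * b + t ^+ 2 * c) -> b = 0.
Proof.
move=> c0 h; apply/eqP; apply: contraT => b0.
(* The minimum would be at -b / c; the denominator c + 1 also covers c = 0 and still makes the
   expression negative. *)
have := h (- b / (c + 1)); have c1 : c + 1 != 0 by lra.
have -> : 2 * (- b / (c + 1)) * b + (- b / (c + 1)) ^+ 2 * c
  = - (b / (c + 1)) ^+ 2 * (c + 2) by field.
rewrite mulNr oppr_ge0 pmulr_lle0; last by lra.
by rewrite leNgt exprn_even_gt0 //= mulf_neq0 ?invr_eq0.
Qed.

Lemma rdotP x y : (forall c, rdot (c *: x) y = 0) -> dot x y = 0.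
Proof.
move=> h; apply: complexP => /=; first by have := h 1; rewrite scale1r.
by have := h 'i%C; rewrite /real_dot dotZl ReI => /eqP; rewrite oppr_eq0 => /eqP.
Qed.

Lemma dot_closure V x : (forall y, V y -> dot x y = 0) ->
  forall y, closure V y -> dot x y = 0.
Proof.
move=> xV y /closure_nm Vy; apply: rdotP => c.
suff le0 z : (forall y, V y -> dot z y = 0) -> rdot z y <= 0.
  apply/eqP; rewrite eq_le; apply/andP; split.
    by apply: le0 => w Vw; rewrite dotZl xV // mulr0.
  by rewrite -oppr_le0 -rdotNl; apply: le0 => w Vw; rewrite dotNl dotZl xV // mulr0 oppr0.
move=> zV; apply/ler_addgt0Pr => e e0; rewrite add0r.
have z1 : 0 < nm z + 1 by rewrite ltr_wpDl ?nm_ge0.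
have [w Vw yw] := Vy _ (divr_gt0 e0 z1).
have -> : rdot z y = rdot z (y - w) by rewrite rdotDr rdotNr {3}/real_dot zV //= subr0.
apply: le_trans (cauchy_schwarz dot_norm _ _) _.
apply: (@le_trans _ _ ((nm z + 1) * nm (y - w))).
  by rewrite ler_wpM2r ?nm_ge0 // lerDl.
by rewrite mulrC -ler_pdivlMr // ltW.
Qed.

(** The vector of least norm in the coset x - closure V is the component of [x] orthogonal to [V]:
    moving it by t z with z in [V] cannot shorten it, so the term linear in t vanishes. *)
Lemma proj_exists V : subspace V -> exists p : H -> H, forall x,
  closure V (p x) /\ forall y, closure V y -> dot (x - p x) y = 0.
Proof.
move=> Vs; suff P x : exists p, closure V p /\ forall y, closure V y -> dot (x - p) y = 0.
  by have [p] := choice P; exists p.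
have cVs := closure_subspace Vs.
pose W := [set x - v | v in closure V].
have [] := @min_norm W.
- by exists (x - 0), 0 => //; exact: cVs.1.
- move=> _ _ [v Vv <-] [w Vw <-]; exists ((2^-1)%:C%C *: (v + w)).
    by apply: (subspaceZ _ cVs); exact: (subspaceD cVs).
  by rewrite addrACA -opprD scalerBr (scalerDr _ x x) half_add_half.
move=> l /closure_nm Wl lmin.
have Vxl : closure V (x - l).
  apply: closureK; apply/closure_nm => e e0; have [_ [v Vv <-] h] := Wl e e0.
  by exists v => //; rewrite nmB opprB addrCA -(opprB x v).
exists (x - l); split=> // y Vy; rewrite opprB addrC subrK.
rewrite dotC; suff -> : dot y l = 0 by rewrite rmorph0.
apply: rdotP => c; rewrite rdotC; set z := c *: y.
have Vz : closure V z by exact: (subspaceZ _ cVs).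
apply: (@rdot_zero _ (nm z ^+ 2)); first exact: sqr_ge0.
move=> t.
have : W (l + t%:C%C *: z).
  exists (x - l - t%:C%C *: z); first by apply: (subspaceB cVs) => //; exact: (subspaceZ _ cVs).
  by rewrite !opprB addrC -addrA subrK addrC.
move=> /lmin /(le_trans (sqr_ge0 _)); rewrite pmulr_rge0 // -!rdotxx !rdotE (rdotC _ z l).
lra.
Qed.

(** The representing vector is a multiple of the component, orthogonal to the kernel, of any [x0] at
    which [phi] does not vanish. *)
Lemma riesz (phi : H -> R[i]) (C : R) :
  (forall c x y, phi (c *: x + y) = c * phi x + phi y) ->
  (forall x, complex.Re (phi x) <= C * nm x) -> exists y, forall x, phi x = dot x y.
Proof.
move=> phil phiC.
have phi0 : phi 0 = 0 by have := phil (- 1) 0 0; rewrite scaler0 addr0 mulN1r addNr.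
have phiZ c x : phi (c *: x) = c * phi x by rewrite -[c *: x]addr0 phil phi0 addr0.
have phiD x y : phi (x + y) = phi x + phi y by rewrite -[x]scale1r phil mul1r scale1r.
have phiB x y : phi (x - y) = phi x - phi y by rewrite phiD -scaleN1r phiZ mulN1r.
have [z0|/existsNP[x0 /eqP px0]] := pselect (forall x, phi x = 0).
  by exists 0 => x; rewrite dot0r z0.
pose K := [set x | phi x = 0].
have Ks : subspace K.
  by split=> [|c x y /= px py]; rewrite /K /= ?phi0 // phil px py mulr0 addr0.
(* The bound gives Re phi <= 0 on the closure of the kernel. Applied to conj(phi x) x, where [phi]
   takes the value |phi x|^2, this forces phi x = 0. *)
have cK x : closure K x -> phi x = 0.
  have le0 y : closure K y -> complex.Re (phi y) <= 0.
    move=> /closure_nm Ky; apply/ler_addgt0Pr => e e0; rewrite add0r.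
    have C1 : 0 < `|C| + 1 by rewrite ltr_wpDl.
    have [k Kk yk] := Ky _ (divr_gt0 e0 C1).
    have := phiC (y - k); rewrite phiB Kk subr0 => /le_trans; apply.
    apply: (@le_trans _ _ ((`|C| + 1) * nm (y - k))).
      by rewrite ler_wpM2r ?nm_ge0 // (le_trans (ler_norm _)) // lerDl.
    by rewrite mulrC -ler_pdivlMr // ltW.
  move=> Kx; have := le0 _ (subspaceZ (Num.conj (phi x)) (closure_subspace Ks) Kx).
  rewrite phiZ mulrC -normCK; case: (eqVneq (phi x) 0) => // nz.
  have : 0 < `|phi x| ^+ 2 by rewrite exprn_gt0 // normr_gt0.
  by rewrite ltcE => /andP[_ /=]; rewrite ltNge => /negPf ->.
have [p pP] := proj_exists Ks; pose z := x0 - p x0.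
have pz : phi z = phi x0 by rewrite phiB (cK _ (pP x0).1) subr0.
have z0 : z <> 0 by move=> z0; move: px0; rewrite -pz z0 phi0 eqxx.
have nz : dot z z != 0.
  by rewrite (dotxx dot_norm) rmorphXn expf_neq0 // fmorph_eq0 gt_eqF ?nm_gt0.
exists (Num.conj (phi z / dot z z) *: z) => x; rewrite dotZr conjCK.
have : dot (x - (phi x / phi z) *: z) z = 0.
  rewrite dotC (pP x0).2 ?rmorph0 //; apply: subset_closure.
  by rewrite /K /= phiB phiZ pz divfK // subrr.
rewrite dotBl dotZl => /eqP; rewrite subr_eq0 => /eqP ->.
by rewrite pz; field; rewrite nz px0.
Qed.

(** [G] is the graph of a linear map on a subspace. It is a relation because in the applications,
    such as a Omega |-> a xi, the value is well defined only thanks to the bound. The map is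
    extended to the closure by completeness and by 0 on the orthogonal complement, which preserves
    the bound [C]. *)
Lemma bounded_extension (G : H -> H -> Prop) (C : R) : 0 <= C ->
  G 0 0 -> (forall c x y x' y', G x y -> G x' y' -> G (c *: x + x') (c *: y + y')) ->
  (forall x y, G x y -> nm y <= C * nm x) ->
  exists T : H -> H, [/\ bounded_op T, forall x, nm (T x) <= C * nm x,
    forall x y, G x y -> T x = y &
    forall x, (forall x' y', G x' y' -> dot x x' = 0) -> T x = 0].
Proof.
move=> C0 G0 Gl GC; pose V := [set x | exists y, G x y].
have Vs : subspace V.
  split; first by exists 0.
  by move=> c x x' [y Gxy] [y' Gxy']; exists (c *: y + y'); exact: Gl.
have [p pP] := proj_exists Vs.
have cVs := closure_subspace Vs.
have p_uniq x q : closure V q -> (forall y, closure V y -> dot (x - q) y = 0) -> p x = q.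
  move=> Vq qP; have Vd : closure V (p x - q) by apply: (subspaceB cVs) => //; exact: (pP x).1.
  have dd : dot (p x - q) (p x - q) = 0.
    rewrite [X in dot X _](_ : _ = (x - q) - (x - p x)).
      by rewrite dotBl qP // (pP x).2 // subrr.
    by rewrite opprB [RHS]addrC subrKA.
  by apply/subr0_eq/eqP; rewrite -(dnorm_eq0 dot); apply/eqP.
have p_lin c x y : p (c *: x + y) = c *: p x + p y.
  apply: p_uniq; first by apply: cVs.2; [exact: (pP x).1 | exact: (pP y).1].
  move=> z Vz; rewrite (_ : _ - _ = c *: (x - p x) + (y - p y)).
    by rewrite dotDl dotZl (pP x).2 // (pP y).2 // mulr0 addr0.
  by rewrite scalerBr opprD addrACA.
have p_bd x : nm (p x) <= nm x.
  apply: nm_le_sq; first exact: nm_ge0.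
  have : rdot (x - p x) (p x) = 0 by rewrite /real_dot (pP x).2 //; exact: (pP x).1.
  move=> h; have := nm_add_sq dot_norm (x - p x) (p x); rewrite subrK h => ->.
  by rewrite mulr0 addr0 lerDr sqr_ge0.
pose approx x y := forall e : R, 0 < e ->
  exists x' y', [/\ G x' y', nm (p x - x') < e & nm (y - y') < e].
have apx_bd x y : approx x y -> nm y <= C * nm (p x).
  move=> a; apply/ler_addgt0Pr => e e0.
  have C1 : 0 < C + 1 by lra.
  have [x' [y' [/GC g hx hy]]] := a _ (divr_gt0 e0 C1).
  have h1 := nm_tri y y' 0; have h2 := nm_tri x' (p x) 0; rewrite !subr0 in h1 h2.
  rewrite nmB in h2.
  have : (C + 1) * (e / (C + 1)) = e by rewrite mulrC divfK // gt_eqF.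
  set k := e / (C + 1) in hx hy *; nra.
have apx_lin c x y x2 y2 : approx x y -> approx x2 y2 -> approx (c *: x + x2) (c *: y + y2).
  move=> a a2 e e0.
  have k0 : 0 <= complex.Re `|c| by have := normr_ge0 c; rewrite lecE => /andP[].
  have k1 : 0 < complex.Re `|c| + 1 by lra.
  set k := complex.Re `|c| in k0 k1.
  have [x' [y' [g hx hy]]] := a _ (divr_gt0 e0 (mulr_gt0 (ltr0n _ 2) k1)).
  have [x2' [y2' [g2 hx2 hy2]]] := a2 _ (divr_gt0 e0 (ltr0n _ 2)).
  have ek : k * (e / (2 * (k + 1))) <= e / 2.
    rewrite (_ : e / 2 = (k + 1) * (e / (2 * (k + 1)))); last by field; lra.
    by rewrite ler_wpM2r ?lerDl // divr_ge0 ?ltW // mulr_gt0.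
  have comb u u' v v' : nm (u - u') < e / (2 * (k + 1)) -> nm (v - v') < e / 2 ->
      nm (c *: u + v - (c *: u' + v')) < e.
    move=> h1 h2; have -> : c *: u + v - (c *: u' + v') = c *: (u - u') + (v - v').
      by rewrite scalerBr opprD addrACA.
    apply: le_lt_trans (nmD _ _) _; rewrite nmZ -/k.
    have := ler_wpM2l k0 (ltW h1); lra.
  exists (c *: x' + x2'), (c *: y' + y2'); split; first exact: Gl.
    by rewrite p_lin; exact: comb.
  exact: comb.
have apx_ex x : exists y, approx x y.
  have C1 : 0 < 2 * C + 1 by lra.
  pose P e y := exists2 x', G x' y & (2 * C + 1) * nm (p x - x') <= e.
  have [] := @complete_nested _ _ P.
  - move=> e e0; have /closure_nm/(_ _ (divr_gt0 e0 C1))[x' [y Gxy] h] := (pP x).1.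
    by exists y, x' => //; rewrite mulrC -ler_pdivlMr // ltW.
  - by move=> e e' y e0 ee' [x' g h]; exists x' => //; exact: le_trans ee'.
  - move=> e y z e0 [x1 g1 h1] [x2 g2 h2].
    have := GC _ _ (Gl (- 1) _ _ _ _ g2 g1); rewrite !scaleN1r ![- _ + _]addrC => h.
    apply: le_trans h _; have := nm_tri x1 (p x) x2; rewrite (nmB x1 (p x)) => h3.
    have := ler_wpM2l C0 h3; have := nm_ge0 (p x - x1); have := nm_ge0 (p x - x2); nra.
  move=> y Py; exists y => e e0.
  have e2 : 0 < e / 2 by rewrite divr_gt0.
  have /closure_nm/(_ _ (divr_gt0 e2 C1))[x' [y' Gxy] h] := (pP x).1.
  exists x', y'; split=> //.
    apply: lt_le_trans h _; rewrite ler_pdivrMr //; nra.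
  rewrite nmB; apply: (@le_lt_trans _ _ (e / 2)); last by lra.
  by apply: Py => //; exists x' => //; rewrite mulrC -ler_pdivlMr // ltW.
have [T TP] := choice apx_ex.
have T_uniq x y : approx x y -> T x = y.
  move=> a; apply/subr0_eq/nm_eq0/eqP; rewrite eq_le nm_ge0 andbT.
  have := apx_lin (- 1) _ _ _ _ a (TP x); rewrite !scaleN1r ![- _ + _]addrC => /apx_bd.
  by rewrite subrr (p_uniq 0 0) ?subrr ?nm0 ?mulr0 //; [exact: cVs.1 | move=> z _; rewrite dot0l].
have T_lin : linear T by move=> c x y; apply: T_uniq; exact: apx_lin.
have T_bd x : nm (T x) <= C * nm x.
  by apply: le_trans (apx_bd _ _ (TP x)) _; rewrite ler_wpM2l.
exists T; split=> //.
- by apply/bounded_opP; split=> //; exists C.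
- move=> x y g; apply: T_uniq => e e0; exists x, y; split=> //.
    rewrite (p_uniq x x) ?subrr ?nm0 //; last by move=> z _; rewrite dot0l.
    by apply: subset_closure; exists y.
  by rewrite subrr nm0.
- move=> x xG; have p0 : p x = 0.
    apply: p_uniq; [exact: cVs.1 | rewrite subr0; apply: dot_closure].
    by move=> y [z]; exact: xG.
  apply/nm_eq0/eqP; rewrite eq_le nm_ge0 andbT.
  by have := apx_bd _ _ (TP x); rewrite p0 nm0 mulr0.
Qed.
End HilbertGeometry.

(** * Bounded operators and von Neumann algebras *)
Section Operators.
Context (R : realType) (H : completeNormedModType R[i]).
Context (dot : {dot H for Num.conj}).
Context (dot_norm : forall x : H, dot x x = `|x| ^+ 2).
Implicit Types (x y z : H) (c : R[i]) (a b s : H -> H) (A S : set (H -> H)).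
Local Notation adj := (adj dot).
Local Notation rdot := (real_dot dot).

Definition norm_bound (C : R) a := forall x, nm (a x) <= C * nm x.

Lemma dot_inj x y : (forall z, dot x z = dot y z) -> x = y.
Proof.
move=> h; apply/subr0_eq/eqP; rewrite -(dnorm_eq0 dot).
by rewrite dotBl h subrr.
Qed.

Lemma opD a x y : bounded_op a -> a (x + y) = a x + a y.
Proof. by move=> [la _]; rewrite -[x]scale1r la !scale1r. Qed.

Lemma op0 a : bounded_op a -> a 0 = 0.
Proof. by move=> ba; apply: (addIr (a 0)); rewrite -opD // !add0r. Qed.

Lemma opZ a c x : bounded_op a -> a (c *: x) = c *: a x.
Proof. by move=> ba; rewrite -[c *: x]addr0 ba.1 op0 // addr0. Qed.

Lemma opN a x : bounded_op a -> a (- x) = - a x.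
Proof. by move=> ba; rewrite -scaleN1r opZ // scaleN1r. Qed.

Lemma opB a x y : bounded_op a -> a (x - y) = a x - a y.
Proof. by move=> ba; rewrite opD // opN. Qed.

Lemma bounded_norm a : bounded_op a -> exists2 C : R, 0 < C & norm_bound C a.
Proof. by move=> /bounded_opP[_ [C /nm_bound_gt0]]. Qed.

Lemma bounded_intro a (C : R) : linear a -> norm_bound C a -> bounded_op a.
Proof. by move=> la aC; apply/bounded_opP; split=> //; exists C. Qed.

Lemma bounded_id : bounded_op (idfun : H -> H).
Proof. by apply: (@bounded_intro _ 1) => // x; rewrite mul1r. Qed.

Lemma bounded_comp a b : bounded_op a -> bounded_op b -> bounded_op (a \o b).
Proof.
move=> ba bb; have [C C0 aC] := bounded_norm ba; have [D D0 bD] := bounded_norm bb.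
apply: (@bounded_intro _ (C * D)) => [c x y|x] /=; first by rewrite bb.1 ba.1.
by apply: le_trans (aC _) _; rewrite -mulrA ler_wpM2l // ltW.
Qed.

Lemma bounded_lin c a b : bounded_op a -> bounded_op b ->
  bounded_op (fun x => c *: a x + b x).
Proof.
move=> ba bb; have [C C0 aC] := bounded_norm ba; have [D D0 bD] := bounded_norm bb.
apply: (@bounded_intro _ (complex.Re `|c| * C + D)) => [d x y|x] /=.
  by rewrite bb.1 ba.1 !scalerDr !scalerA (mulrC c) addrACA.
apply: le_trans (nmD _ _) _; rewrite mulrDl lerD // nmZ -mulrA ler_wpM2l //.
by have := normr_ge0 c; rewrite lecE => /andP[].
Qed.

Lemma bounded_zero : bounded_op (fun=> 0 : H).
Proof. by apply: (@bounded_intro _ 0) => [c x y|x]; rewrite ?scaler0 ?addr0 // nm0 mul0r. Qed.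

Lemma bounded_scale c a : bounded_op a -> bounded_op (fun x => c *: a x).
Proof.
move=> ba; have := bounded_lin c ba bounded_zero.
by congr bounded_op; apply/funext => x; rewrite addr0.
Qed.

Lemma adj_uniq a b : (forall x y, dot (a x) y = dot x (b y)) -> adj a = b.
Proof.
move=> ab; have ex : exists b, forall x y, dot (a x) y = dot x (b y) by exists b.
have := getPex ex; rewrite -/(adj a) => h; apply/funext => y.
by apply: dot_inj => z; rewrite dotC -h ab -dotC.
Qed.

Lemma adjP a x y : bounded_op a -> dot (a x) y = dot x (adj a y).
Proof.
move=> ba; have [C C0 aC] := bounded_norm ba.
have ex1 z : exists w, forall u, dot (a u) z = dot u w.
  apply: (@riesz _ _ _ dot_norm _ (C * nm z)) => [c u v|u].
    by rewrite ba.1 dotDl dotZl.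
  apply: le_trans (cauchy_schwarz dot_norm _ _) _.
  by rewrite mulrAC ler_wpM2r ?nm_ge0.
have [b bP] := choice ex1.
have ex : exists b, forall x y, dot (a x) y = dot x (b y) by exists b.
exact: (getPex ex).
Qed.

Lemma adjPr a x y : bounded_op a -> dot x (a y) = dot (adj a x) y.
Proof. by move=> ba; rewrite dotC adjP // -dotC. Qed.

Lemma norm_bound_adj a (C : R) : bounded_op a -> 0 <= C -> norm_bound C a ->
  norm_bound C (adj a).
Proof.
move=> ba C0 aC y; have [->|y0] := pselect (adj a y = 0).
  by rewrite nm0 mulr_ge0 ?nm_ge0.
rewrite -(ler_pM2l (nm_gt0 y0)) -expr2 -(rdotxx dot_norm) /real_dot -adjP //.
apply: le_trans (cauchy_schwarz dot_norm _ _) _.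
by rewrite mulrA ler_wpM2r ?nm_ge0 // mulrC.
Qed.

Lemma bounded_adj a : bounded_op a -> bounded_op (adj a).
Proof.
move=> ba; have [C C0 aC] := bounded_norm ba.
apply: (@bounded_intro _ C); last by apply: norm_bound_adj; rewrite // ltW.
move=> c x y; apply: dot_inj => z.
by rewrite dotDl dotZl -!adjPr // dotDl dotZl.
Qed.

Lemma adjK a : bounded_op a -> adj (adj a) = a.
Proof. by move=> ba; apply: adj_uniq => x y; rewrite -adjPr. Qed.

Lemma adj_comp a b : bounded_op a -> bounded_op b -> adj (a \o b) = adj b \o adj a.
Proof. by move=> ba bb; apply: adj_uniq => x y /=; rewrite !adjP. Qed.

Lemma adj_id : adj idfun = idfun.
Proof. exact: adj_uniq. Qed.

Lemma adj_lin c a b : bounded_op a -> bounded_op b ->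
  adj (fun x => c *: a x + b x) = fun x => Num.conj c *: adj a x + adj b x.
Proof.
move=> ba bb; apply: adj_uniq => x y.
by rewrite dotDl dotZl !adjP // dotDr dotZr conjCK.
Qed.

Lemma adj_scale c a : bounded_op a -> adj (fun x => c *: a x) = fun x => Num.conj c *: adj a x.
Proof. by move=> ba; apply: adj_uniq => x y; rewrite dotZl dotZr adjP // conjCK. Qed.

Lemma commutantP S a : commutant S a <->
  bounded_op a /\ forall s x, S s -> a (s x) = s (a x).
Proof.
split=> [[ba h]|[ba h]]; split=> // s.
  by move=> x Ss; have := congr1 (@^~ x) (h s Ss).
by move=> Ss; apply/funext => x /=; exact: h.
Qed.

Lemma commutantS S T : S `<=` T -> commutant T `<=` commutant S.
Proof. by move=> ST a [ba h]; split=> // s /ST; exact: h. Qed.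

Lemma sub_bicommutant S : S `<=` bounded_op -> S `<=` commutant (commutant S).
Proof. by move=> Sb s Ss; split; [exact: Sb | move=> t [_ ->]]. Qed.

Lemma commutant_bounded S : commutant S `<=` bounded_op.
Proof. by move=> a []. Qed.

Lemma tricommutant S : S `<=` bounded_op ->
  commutant (commutant (commutant S)) = commutant S.
Proof.
move=> Sb; apply/seteqP; split; last by apply: sub_bicommutant; exact: commutant_bounded.
by apply: commutantS; exact: sub_bicommutant.
Qed.

Lemma commutant_adj S a : S `<=` bounded_op -> (forall s, S s -> S (adj s)) ->
  commutant S a -> commutant S (adj a).
Proof.
move=> Sb Sadj /commutantP[ba h]; apply/commutantP; split; first exact: bounded_adj.
move=> s x Ss; apply: dot_inj => z; have bs := Sb _ Ss.
rewrite -(adjK ba) -(adjK bs) -!adjPr ?adjK //; do ?exact: bounded_adj.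
by rewrite h //; exact: Sadj.
Qed.

Lemma commutant_vN S : S `<=` bounded_op -> (forall s, S s -> S (adj s)) ->
  von_neumann dot (commutant S).
Proof. by move=> Sb Sa; split; [move=> a; exact: commutant_adj | exact: tricommutant]. Qed.

Section VonNeumann.
Context (A : set (H -> H)) (vA : von_neumann dot A).

Lemma vN_bounded a : A a -> bounded_op a.
Proof. by rewrite -vA.2 => -[]. Qed.

Lemma vN_adj a : A a -> A (adj a).
Proof. exact: vA.1. Qed.

(** The bicommutant condition as a membership test. Operators obtained as limits, extensions or
    projections are placed in [A] by checking that they commute with its commutant. *)
Lemma vN_intro a : bounded_op a -> (forall s x, commutant A s -> a (s x) = s (a x)) -> A a.
Proof. by move=> ba h; rewrite -vA.2; apply/commutantP. Qed.

Lemma vN_comm a s x : A a -> commutant A s -> a (s x) = s (a x).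
Proof. by move=> Aa /commutantP[_ h]; rewrite h. Qed.

Lemma vN_comp a b : A a -> A b -> A (a \o b).
Proof.
move=> Aa Ab; apply: vN_intro; first by apply: bounded_comp; exact: vN_bounded.
by move=> s x As /=; rewrite (vN_comm _ Ab) // (vN_comm _ Aa).
Qed.

Lemma vN_lin c a b : A a -> A b -> A (fun x => c *: a x + b x).
Proof.
move=> Aa Ab; apply: vN_intro; first by apply: bounded_lin; exact: vN_bounded.
by move=> s x As /=; rewrite (vN_comm _ Ab) // (vN_comm _ Aa) // -(proj1 As.1).
Qed.

Lemma vN_scale c a : A a -> A (fun x => c *: a x).
Proof.
move=> Aa; apply: vN_intro; first by apply: bounded_scale; exact: vN_bounded.
by move=> s x As; rewrite (vN_comm _ Aa) // (opZ _ _ As.1).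
Qed.

Lemma vN_id : A idfun.
Proof. by apply: vN_intro => //; exact: bounded_id. Qed.

Lemma commutant_vN_adj s : commutant A s -> commutant A (adj s).
Proof. by apply: commutant_adj; [exact: vN_bounded | exact: vN_adj]. Qed.

End VonNeumann.

Lemma vN_generated_sub S : S `<=` vN_generated dot S.
Proof. exact: sub_smallest. Qed.

Lemma vN_generated_vN S : S `<=` bounded_op -> von_neumann dot (vN_generated dot S).
Proof.
move=> Sb; split=> [a h B [vB SB]|]; first by apply: (vN_adj vB); exact: h.
apply/seteqP; split=> [a [ba h] B [vB SB]|].
  apply: (vN_intro vB) => // s x Bs.
  have gs : commutant (vN_generated dot S) s by apply: (commutantS _ Bs) => b; apply.
  by have := congr1 (@^~ x) (h s gs).
(* [commutant set0] consists of all bounded operators; it is a von Neumann algebra containing [S],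
   so generated elements are bounded. *)
apply: sub_bicommutant => a /(_ (commutant set0)) h; apply: commutant_bounded (h _).
by split; [exact: commutant_vN | move=> b /Sb bb; split].
Qed.

End Operators.
Arguments bounded_id {R} H.

(** * Square roots, unitaries and polar decomposition *)
Section SquareRoot.
Context (R : realType) (H : completeNormedModType R[i]).
Context (dot : {dot H for Num.conj}).
Context (dot_norm : forall x : H, dot x x = `|x| ^+ 2).
Implicit Types (x y z : H) (c : R[i]) (a b s : H -> H) (A S : set (H -> H)).
Local Notation adj := (adj dot).
Local Notation rdot := (real_dot dot).

Lemma cvg_nm (T : Type) (F : set_system T) (FF : Filter F) (u : T -> H) l :
  (forall e : R, 0 < e -> \forall t \near F, nm (u t - l) <= e) ->
  u t @[t --> F] --> l.
Proof.
move=> h; apply/cvgrPdist_le => e e0; have [re0 eE] := complex_gt0 e0.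
have := h _ re0; apply: filterS => n; rewrite nmB => hn.
by rewrite nmE eE lecR.
Qed.

Lemma vanish_closure a (D : set H) : bounded_op a ->
  (forall x, D x -> a x = 0) -> forall x, closure D x -> a x = 0.
Proof.
move=> ba aD x /closure_nm Dx; have [C C0 aC] := bounded_norm ba.
apply/nm_eq0/eqP; rewrite eq_le nm_ge0 andbT; apply/ler_addgt0Pr => e e0.
have [d Dd h] := Dx _ (divr_gt0 e0 C0).
rewrite add0r -[a _]subr0 -(aD _ Dd) -opB //; apply: le_trans (aC _) _.
by rewrite mulrC -ler_pdivlMr // ltW.
Qed.

Lemma vanish_subspace a (D : set H) : bounded_op a -> subspace D ->
  (forall x, D x -> a x = 0) -> (forall x, (forall y, D y -> dot x y = 0) -> a x = 0) ->
  forall x, a x = 0.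
Proof.
move=> ba Ds aD aDo x; have [p pP] := proj_exists dot_norm Ds.
rewrite -(subrK (p x) x) opD // aDo ?add0r; last first.
  by move=> y Dy; apply: (pP x).2; exact: subset_closure.
exact: (vanish_closure ba aD (pP x).1).
Qed.

(* The iteration z <- (b + z^2) / 2 is dominated by its scalar version
   t <- (1 + t^2) / 2, hence converges to a solution of (1 - z)^2 = 1 - b. *)
Lemma sqrt_exists b : bounded_op b -> adj b = b -> norm_bound 1 b ->
  exists y : H -> H, [/\ bounded_op y, adj y = y, forall x, y (y x) = x - b x &
    forall s, bounded_op s -> (forall x, s (b x) = b (s x)) ->
      forall x, s (y x) = y (s x)].
Proof.
move=> bb badj b1.
pose h : R[i] := (2^-1)%:C%C.
have hJ : Num.conj h = h by exact: conjR.
have hh : complex.Re `|h| = 2^-1.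
  by rewrite ger0_norm // lecR invr_ge0.
pose Z := fix Z n := if n is n'.+1 then fun x => h *: (b x + Z n' (Z n' x)) else fun=> 0 : H.
pose t := fix t n := if n is n'.+1 then (1 + t n' ^+ 2) / 2 else 0 : R.
have t01 n : 0 <= t n <= 1.
  by elim: n => [|n /andP[t0 t1]] /=; rewrite ?lexx ?ler01 //; apply/andP; split; nra.
have tS n : t n <= t n.+1 by have /andP[] := t01 n => t0 t1 /=; nra.
have Zb n : bounded_op (Z n).
  elim: n => [|n IH] /=; first by apply: (@bounded_intro _ _ _ 0) => [c x y|x];
    rewrite ?scaler0 ?addr0 // nm0 mul0r.
  have := bounded_lin h bb (bounded_lin (h - 1) (bounded_comp IH IH) (bounded_comp IH IH)).
  congr bounded_op; apply/funext => x /=.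
  by rewrite scalerDr scalerBl scale1r subrK.
have Zc n s : bounded_op s -> (forall x, s (b x) = b (s x)) -> forall x, s (Z n x) = Z n (s x).
  move=> bs sb; elim: n => [|n IH] x /=; first by rewrite op0.
  by rewrite opZ // opD // sb !IH.
have ZZ n m x : Z n (Z m x) = Z m (Z n x).
  by apply: (Zc) => // {}x; rewrite -(Zc n b).
have Zt n : norm_bound (t n) (Z n).
  elim: n => [|n IH] x /=; first by rewrite nm0 mul0r.
  rewrite nmZ hh; have := nmD (b x) (Z n (Z n x)); have := b1 x; have := IH x.
  have := IH (Z n x); have /andP[t0 t1] := t01 n; have := nm_ge0 x; rewrite mul1r.
  move=> x0 h1 h2 h3 h4; have := ler_wpM2l t0 h2; nra.
(* Because the iterates commute, the difference of two squares factors as (Z_{n+1} + Z_n)(Z_{n+1} -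
   Z_n), and the scalar recursion factors in the same way. The increments of [Z] are thus bounded by
   those of [t], which telescope. *)
have dZ n x : nm (Z n.+1 x - Z n x) <= (t n.+1 - t n) * nm x.
  elim: n x => [|n IH] x.
    rewrite /= !subr0 expr0n /= addr0 addr0 mul1r nmZ hh.
    by rewrite ler_pM2l // (le_trans (b1 x)) ?mul1r.
  have -> : Z n.+2 x - Z n.+1 x = h *: (Z n.+1 (Z n.+1 x - Z n x) + Z n (Z n.+1 x - Z n x)).
    rewrite (opB _ _ (Zb n.+1)) (opB _ _ (Zb n)) (ZZ n n.+1) subrKA.
    by rewrite [Z n.+2 x]/= [X in _ - X]/= -scalerBr opprD addrACA subrr add0r.
  rewrite nmZ hh; have := nmD (Z n.+1 (Z n.+1 x - Z n x)) (Z n (Z n.+1 x - Z n x)).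
  have := Zt n.+1 (Z n.+1 x - Z n x); have := Zt n (Z n.+1 x - Z n x).
  have /andP[t0 t1] := t01 n; have /andP[s0 s1] := t01 n.+1.
  have := ler_wpM2l (addr_ge0 s0 t0) (IH x).
  rewrite [t n.+2]/=; have : 2 * t n.+1 = 1 + t n ^+ 2 by rewrite /= mulrC divfK.
  set T := t n.+1; set a1 := nm _; set a2 := nm _; set a3 := nm _; set a4 := nm (_ + _).
  move=> hT h1 h2 h3 h4.
  rewrite (_ : ((1 + T ^+ 2) / 2 - T) = (T + t n) * (T - t n) / 2); last by lra.
  have := mulrA (T + t n) (T - t n) (nm x); nra.
have dZm n k x : nm (Z (n + k)%N x - Z n x) <= (t (n + k)%N - t n) * nm x.
  elim: k => [|k IH]; first by rewrite addn0 !subrr nm0 mul0r.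
  have := nm_tri (Z (n + k.+1)%N x) (Z (n + k)%N x) (Z n x); rewrite addnS.
  have := dZ (n + k)%N x; lra.
pose Q := range t.
have Q0 : has_sup Q.
  by split; [exists 0, 0%N | exists 1 => _ [n _ <-]; case/andP: (t01 n)].
pose T := sup Q.
have tT n : t n <= T by apply: ub_le_sup; [exact: Q0.2 | exists n].
have tmon n k : t n <= t (n + k)%N.
  by elim: k => [|k IH]; rewrite ?addn0 // addnS (le_trans IH).
have Tt e : 0 < e -> \forall n \near \oo, T - t n <= e.
  move=> e0; have [_ [N _ <-] hN] := sup_adherent e0 Q0.
  exists N => // n /= /subnKC <-; have := tmon N (n - N)%N; rewrite -/T in hN; lra.
have [z zP] : exists z : H -> H, forall x e, 0 < e -> \forall n \near \oo, nm (Z n x - z x) <= e.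
  suff ex x : exists z, forall e, 0 < e -> \forall n \near \oo, nm (Z n x - z) <= e.
    by have [z zP] := choice ex; exists z.
  pose P e y := exists n, y = Z n x /\ (T - t n) * nm x <= e.
  have near e : 0 < e -> \forall n \near \oo, (T - t n) * nm x <= e.
    move=> e0; have x1 : 0 < nm x + 1 by rewrite ltr_wpDl ?nm_ge0.
    apply: filterS (Tt _ (divr_gt0 e0 x1)) => n; rewrite ler_pdivlMr // => hn.
    by apply: le_trans hn; rewrite ler_wpM2l ?lerDl // subr_ge0.
  have [] := @complete_nested _ _ P.
  - by move=> e /near[n _ /(_ n (leqnn n)) hn]; exists (Z n x), n.
  - by move=> e e' y e0 ee' [n [-> hn]]; exists n; split=> //; exact: le_trans ee'.
  - move=> e _ _ e0 [n [-> hn]] [m [-> hm]].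
    wlog nm : n m hn hm / (n <= m)%N.
      by move=> W; have [/W|/ltnW/W] := leqP n m; rewrite 1?nmB; apply.
    rewrite nmB -(subnKC nm); apply: le_trans (dZm _ _ _) _; apply: le_trans hn.
    by rewrite ler_wpM2r ?nm_ge0 // lerB.
  move=> l lP; exists l => e e0; apply: filterS (near _ e0) => n hn.
  by apply: lP => //; exists n.
have zcvg x : Z n x @[n --> \oo] --> z x by apply: cvg_nm; exact: zP.
have zlim x l : Z n x @[n --> \oo] --> l -> z x = l.
  by move=> hl; apply: (@cvg_unique _ (@norm_hausdorff _ H) _ _ _ _ (zcvg x) hl).
have zlin : linear z.
  move=> c x y; apply: zlim.
  have -> : (fun n => Z n (c *: x + y)) = fun n => c *: Z n x + Z n y.
    by apply/funext => n; rewrite (proj1 (Zb n)).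
  by apply: cvgD; [apply: cvgZr|]; exact: zcvg.
have z1 : norm_bound 1 z.
  move=> x; rewrite mul1r; apply/ler_addgt0Pr => e e0.
  near \oo => n; have hn : nm (Z n x - z x) <= e by near: n; exact: zP.
  have := nm_tri (z x) (Z n x) 0; rewrite !subr0 (nmB (z x)).
  have := Zt n x; have /andP[t0 t1] := t01 n; have := nm_ge0 x; nra.
have zb : bounded_op z by exact: (bounded_intro zlin z1).
have Zadj n x y : dot (Z n x) y = dot x (Z n y).
  elim: n x y => [|n IH] x y /=; first by rewrite dot0l dot0r.
  by rewrite dotZl dotZr hJ dotDl dotDr !IH (adjP dot_norm) // badj.
have zadj x y : dot (z x) y = dot x (z y).
  suff zr u v : rdot (z u) v = rdot u (z v).
    apply: complexP; first exact: zr.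
    apply: oppr_inj; rewrite -!ReI -!dotZl.
    have := zr ('i%C *: x) y; rewrite /real_dot.
    by rewrite (_ : z ('i%C *: x) = 'i%C *: z x) //; exact: opZ.
  apply/eqP; rewrite -subr_eq0 -normr_le0; apply/ler_addgt0Pr => e e0.
  have k0 : 0 < nm u + nm v + 1 by have := nm_ge0 u; have := nm_ge0 v; lra.
  have ek := divr_gt0 e0 k0.
  near \oo => n.
  have h1 : nm (Z n u - z u) <= e / (nm u + nm v + 1) by near: n; exact: zP.
  have h2 : nm (Z n v - z v) <= e / (nm u + nm v + 1) by near: n; exact: zP.
  have -> : rdot (z u) v - rdot u (z v) = rdot u (Z n v - z v) - rdot (Z n u - z u) v.
    have : rdot (Z n u) v = rdot u (Z n v) by rewrite /real_dot Zadj.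
    by rewrite !rdotE => ->; ring.
  have r1 := rdot_abs dot_norm u (Z n v - z v).
  have r2 := rdot_abs dot_norm (Z n u - z u) v.
  have := ler_normB (rdot u (Z n v - z v)) (rdot (Z n u - z u) v).
  have := ler_wpM2l (nm_ge0 u) h2; have := ler_wpM2r (nm_ge0 v) h1.
  have : e / (nm u + nm v + 1) * (nm u + nm v + 1) = e by rewrite divfK // gt_eqF.
  have := ltW ek; set E := e / (_ + _ + 1) => *; nra.
have zc s : bounded_op s -> (forall x, s (b x) = b (s x)) -> forall x, s (z x) = z (s x).
  move=> bs sb x; apply/esym/zlim.
  have -> : (fun n => Z n (s x)) = fun n => s (Z n x).
    by apply/funext => n; rewrite Zc.
  by apply: continuous_cvg; [exact: bs.2 | exact: zcvg].
have zzcvg x : Z n (Z n x) @[n --> \oo] --> z (z x).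
  apply: cvg_nm => e e0; have e2 : 0 < e / 2 by rewrite divr_gt0.
  near=> n.
  have h1 : nm (Z n x - z x) <= e / 2 by near: n; exact: zP.
  have h2 : nm (Z n (z x) - z (z x)) <= e / 2 by near: n; exact: zP.
  have := nm_tri (Z n (Z n x)) (Z n (z x)) (z (z x)); rewrite -(opB _ _ (Zb n)).
  have := Zt n (Z n x - z x); have /andP[t0 t1] := t01 n; have := nm_ge0 (Z n x - z x); nra.
have zE x : z x = h *: (b x + z (z x)).
  apply: zlim; rewrite -(cvg_shiftS (fun n => Z n x)) /=.
  apply: cvgZr; apply: cvgD; [exact: cvg_cst | exact: zzcvg].
exists (fun x => x - z x); split.
- have := bounded_lin (-1) zb (bounded_id H); congr bounded_op.
  by apply/funext => x /=; rewrite scaleN1r addrC.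
- by apply: adj_uniq => x y; rewrite dotBl dotBr zadj.
- move=> x; rewrite opB //; have := zE x; set u := z (z x) => zxE.
  have : z x + z x = b x + u by rewrite {1 2}zxE half_add_half.
  by move=> e2; rewrite opprB addrACA -opprD e2 opprD addrACA subrr addr0.
- by move=> s bs sb x; rewrite opB // zc.
Unshelve. all: by end_near. Qed.

End SquareRoot.

Section PolarDecomposition.
Context (R : realType) (H : completeNormedModType R[i]).
Context (dot : {dot H for Num.conj}).
Context (dot_norm : forall x : H, dot x x = `|x| ^+ 2).
Implicit Types (x y z : H) (c : R[i]) (a b s : H -> H).
Local Notation adj := (adj dot).
Local Notation rdot := (real_dot dot).
Context (A : set (H -> H)) (vA : von_neumann dot A).

Lemma conj_i : Num.conj ('i%C : R[i]) = - 'i%C.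
Proof. by apply: complexP => //=; rewrite oppr0. Qed.

(** With c = i these are a + i sqrt(1 - a^2) and a - i sqrt(1 - a^2): the root commutes with [a], so
    the product with the adjoint is a^2 + (1 - a^2) = 1. A single [y] serves both signs, so that [a]
    is the mean of the two unitaries. *)
Lemma selfadj_unitary a c : A a -> adj a = a -> norm_bound 1 a ->
  Num.conj c = - c -> c * c = -1 ->
  exists y : H -> H, A y /\ forall d, d = c \/ d = - c ->
    A (fun x => d *: y x + a x) /\ unitary_op dot (fun x => d *: y x + a x).
Proof.
move=> Aa aa a1 cJ cc; have ba := vN_bounded vA Aa.
have bb : bounded_op (a \o a) by exact: bounded_comp.
have [||y [by_ ya yy yc]] := sqrt_exists dot_norm bb.
- by rewrite (adj_comp dot_norm) // aa.
- by move=> x /=; rewrite mul1r (le_trans (a1 _)) // mul1r (le_trans (a1 _)) // mul1r.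
have Ay : A y.
  apply: (vN_intro vA) => // s x As; apply/esym/yc; first exact: commutant_bounded As.
  by move=> {}x /=; rewrite -!(vN_comm _ Aa As).
have ay x : a (y x) = y (a x) by apply: yc.
exists y; split=> // d dc.
have dJ : Num.conj d = - d by case: dc => ->; [exact: cJ | rewrite rmorphN /= cJ].
have dd : d * d = -1 by case: dc => ->; rewrite ?mulrNN.
have Aw : A (fun x => d *: y x + a x) by exact: (vN_lin vA).
split=> //; split; first exact: (vN_bounded vA Aw).
  rewrite (adj_lin dot_norm) // ya aa dJ; apply/funext => x /=.
  rewrite !(opD _ _ by_) !(opD _ _ ba) !(opZ _ _ by_) !(opZ _ _ ba) scalerDr scalerA mulNr
    dd opprK scale1r yy ay.
  by rewrite scaleNr addrA subrK subrK.
rewrite (adj_lin dot_norm) // ya aa dJ; apply/funext => x /=.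
rewrite !(opD _ _ by_) !(opD _ _ ba) !(opZ _ _ by_) !(opZ _ _ ba) scalerDr scalerA mulrN dd
  opprK scale1r yy ay.
by rewrite scaleNr addrA addrK subrK.
Qed.

Lemma commute_unitaries (L : H -> H) : bounded_op L ->
  (forall w, A w -> unitary_op dot w -> forall x, L (w x) = w (L x)) ->
  forall n x, A n -> L (n x) = n (L x).
Proof.
move=> bL Lw.
have step1 a x : A a -> adj a = a -> norm_bound 1 a -> L (a x) = a (L x).
  move=> Aa aa a1; have cc : ('i%C * 'i%C : R[i]) = -1 by rewrite -expr2 sqr_i.
  have [y [Ay yP]] := selfadj_unitary Aa aa a1 conj_i cc.
  have [A1 u1] := yP _ (or_introl erefl); have [A2 u2] := yP _ (or_intror erefl).
  have := Lw _ A1 u1 x; have := Lw _ A2 u2 x => /(congr1 (fun z => (2^-1)%:C%C *: z)).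
  move=> e2 /(congr1 (fun z => (2^-1)%:C%C *: z)) e1.
  have : forall u v : H, (2^-1)%:C%C *: ('i%C *: u + v) + (2^-1)%:C%C *: (- 'i%C *: u + v) = v.
    move=> u v; rewrite -scalerDr addrACA scaleNr subrr add0r scalerDr half_add_half //.
  move=> hv; rewrite -(hv (y x) (a x)) (opD _ _ bL) !(opZ _ _ bL).
  by rewrite e1 e2 hv.
have step2 a x : A a -> adj a = a -> L (a x) = a (L x).
  move=> Aa aa; have ba := vN_bounded vA Aa; have [D D0 aD] := bounded_norm ba.
  have DN : (D%:C%C : R[i]) != 0 by rewrite fmorph_eq0 gt_eqF.
  have := @step1 (fun x => (D^-1)%:C%C *: a x) x; rewrite (opZ _ _ bL) => h.
  have : (D^-1)%:C%C *: L (a x) = (D^-1)%:C%C *: a (L x).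
    apply: h; first exact: (vN_scale vA).
      by rewrite (adj_scale dot_norm) // aa conjR.
    move=> u; rewrite nmZ mul1r (_ : complex.Re _ = D^-1); first by rewrite ler_pdivrMl.
    by rewrite ger0_norm // lecR invr_ge0 ltW.
  move=> /(congr1 (fun z => D%:C%C *: z)); rewrite !scalerA -rmorphM.
  by rewrite divff ?gt_eqF // !scale1r.
move=> n x An; have bn := vN_bounded vA An; have bn' := bounded_adj dot_norm bn.
have An' := vN_adj vA An.
have h1 := @step2 (fun x => 1 *: n x + adj n x) x (vN_lin vA _ An An').
have h2 := @step2 (fun x => 'i%C *: n x + (- 'i%C) *: adj n x) x
  (vN_lin vA _ An (vN_scale vA _ An')).
rewrite (adj_lin dot_norm) // (adjK dot_norm) // in h1.
rewrite (adj_lin dot_norm) // ?(adj_scale dot_norm) // ?(adjK dot_norm) // in h2;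
  last exact: bounded_scale.
have {}h1 : L (n x) + L (adj n x) = n (L x) + adj n (L x).
  move: h1; rewrite (opD _ _ bL) !(opZ _ _ bL) !scale1r; apply.
  by apply/funext => z; rewrite rmorph1 !scale1r addrC.
have {}h2 : L (n x) - L (adj n x) = n (L x) - adj n (L x).
  apply: (@scalerI _ _ 'i%C); first by rewrite eq_complex /= oner_eq0 andbF.
  move: h2; rewrite (opD _ _ bL) !(opZ _ _ bL) !scalerBr !scaleNr; apply.
  by apply/funext => z; rewrite rmorphN /= conj_i opprK addrC.
have : L (n x) + L (n x) = n (L x) + n (L x).
  by have := congr2 +%R h1 h2; rewrite !addrA [L _ + L _ + _]addrAC addrK [_ + adj n _ +
    _]addrAC addrK.
move=> /(congr1 (fun z => (2^-1)%:C%C *: z)); rewrite !scalerDr !half_add_half //.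
Qed.

(* w is the partial isometry of the polar decomposition of x. *)
Lemma polar (x e f : H -> H) : A x -> norm_bound 1 x -> bounded_op e ->
  bounded_op f -> (forall h, e (x h) = x h) -> (forall h, x (f h) = x h) ->
  (exists h, x h <> 0) -> exists w : H -> H, [/\ A w,
    forall h, adj w (w (adj w (w h))) = adj w (w h),
    forall h, e (w h) = w h, forall h, w (f h) = w h & exists h, w h <> 0].
Proof.
move=> Ax x1 be bf ex xf [h0 xh0]; have bx := vN_bounded vA Ax.
have bx' := bounded_adj dot_norm bx; have bxx : bounded_op (adj x \o x) by exact: bounded_comp.
have xx_adj : adj (adj x \o x) = adj x \o x.
  by rewrite (adj_comp dot_norm) // (adjK dot_norm).
(* [sqrt_exists] provides a root of 1 - b, so this choice of [b] makes [y] the absolute value of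
   [x]. *)
pose b h := h - adj x (x h).
have bb : bounded_op b.
  have := bounded_lin (-1) bxx (bounded_id H); congr bounded_op.
  by apply/funext => h /=; rewrite scaleN1r addrC.
have b_adj : adj b = b.
  by apply: adj_uniq => u v; rewrite dotBl dotBr -(adjP dot_norm) // -(adjPr dot_norm).
have b1 : norm_bound 1 b.
  move=> h; rewrite mul1r; apply: nm_le_sq; first exact: nm_ge0.
  rewrite -!(rdotxx dot_norm) /b !rdotE.
  rewrite (rdotC dot (adj x (x h)) h) {2 3}/real_dot -(adjP dot_norm) // -!/(rdot _ _).
  rewrite !(rdotxx dot_norm).
  have := norm_bound_adj dot_norm bx ler01 x1 (x h); have := nm_ge0 (adj x (x h)).
  rewrite mul1r => n0 n1; have := nm_ge0 (x h); nra.
have [y [by_ ya yy yc]] := sqrt_exists dot_norm bb b_adj b1.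
have {}yy h : y (y h) = adj x (x h) by rewrite yy /b opprB addrC subrK.
have yx u v : dot (y u) (y v) = dot (x u) (x v).
  by rewrite (adjP dot_norm) // ya yy -(adjP dot_norm).
have [w [bw w1 wyx w0]] : exists T : H -> H, [/\ bounded_op T, norm_bound 1 T,
    forall h, T (y h) = x h & forall k, (forall h, dot k (y h) = 0) -> T k = 0].
  have [|||T [bT T1 TG T0]] := @bounded_extension _ _ _ dot_norm
    (fun u v => exists h, u = y h /\ v = x h) 1 ler01.
  - by exists 0; rewrite (op0 by_) (op0 bx).
  - by move=> c _ _ _ _ [h [-> ->]] [k [-> ->]]; exists (c *: h + k); rewrite !opD // !opZ.
  - move=> _ _ [h [-> ->]]; rewrite mul1r; apply: nm_le_sq; first exact: nm_ge0.
    by rewrite -!(rdotxx dot_norm) /real_dot yx.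
  exists T; split=> //; first by move=> h; apply: TG; exists h.
  by move=> k kh; apply: T0 => _ _ [h [-> _]].
pose D := [set y h | h in setT].
have Ds : subspace D.
  split; first by exists 0; rewrite ?(op0 by_).
  by move=> c _ _ [h _ <-] [k _ <-]; exists (c *: h + k); rewrite // opD // opZ.
(* The defining properties of [w] describe it on the range of |x| and on the orthogonal complement
   only; every identity below is checked on these two pieces. *)
have agree a a' : bounded_op a -> bounded_op a' -> (forall h, a (y h) = a' (y h)) ->
    (forall k, (forall h, dot k (y h) = 0) -> a k = a' k) -> forall h, a h = a' h.
  move=> ba ba' e1 e2 h; apply/subr0_eq.
  apply: (@vanish_subspace _ _ _ dot_norm (fun h => a h - a' h) D) => //.
  - have := bounded_lin (-1) ba' ba; congr bounded_op.
    by apply/funext => u; rewrite scaleN1r addrC.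
  - by move=> _ [k _ <-]; rewrite e1 subrr.
  - by move=> k kD; rewrite e2 ?subrr // => u; apply: kD; exists u.
have bw' := bounded_adj dot_norm bw.
have Aw : A w.
  apply: (vN_intro vA) => // s h As; have bs := commutant_bounded As.
  have As' := commutant_vN_adj dot_norm vA As.
  have ys k t : commutant A t -> y (t k) = t (y k).
    move=> At; apply/esym/yc; first exact: commutant_bounded At.
    move=> {}k; rewrite /b (opB _ _ (commutant_bounded At)).
    by rewrite (vN_comm _ Ax At) (vN_comm _ (vN_adj vA Ax) At).
  apply: (agree (w \o s) (s \o w) _ _ _ _ h); [exact: bounded_comp| exact: bounded_comp | |].
    by move=> k /=; rewrite -ys // !wyx (vN_comm _ Ax As).
  move=> k ky /=; rewrite (w0 k) // op0 // w0 // => u.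
  by rewrite (adjP dot_norm) // -ys // ky.
have xw h : adj x (w h) = y h.
  apply: (agree (adj x \o w) y _ _ _ _ h); [exact: bounded_comp | by [] | |].
    by move=> k /=; rewrite wyx yy.
  move=> k ky /=; rewrite w0 // op0 //; apply: (dot_inj (dot := dot)) => z.
  by rewrite dot0l (adjP dot_norm) // ya ky.
have wwy h : adj w (w (y h)) = y h.
  rewrite wyx; apply: (dot_inj (dot := dot)) => z.
  by rewrite -(adjPr dot_norm) // (adjP dot_norm) // xw (adjP dot_norm) // ya.
have yf h : y (f h) = y h.
  apply/subr0_eq/nm_eq0/eqP; rewrite -sqrf_eq0 -(rdotxx dot_norm) /real_dot -opB // yx.
  by rewrite opB // xf subrr dot0l.
exists w; split=> //.
- move=> h; have bww : bounded_op (adj w \o w) by exact: bounded_comp.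
  apply: (agree ((adj w \o w) \o (adj w \o w)) (adj w \o w) _ _ _ _ h) => //;
    first exact: bounded_comp.
    by move=> k /=; rewrite !wwy.
  by move=> k ky /=; rewrite (w0 k) // !op0.
- move=> h; apply: (agree (e \o w) w _ _ _ _ h) => //; first exact: bounded_comp.
    by move=> k /=; rewrite wyx ex.
  by move=> k ky /=; rewrite w0 // op0.
- move=> h; apply/subr0_eq; rewrite -opB //; apply: w0 => k.
  by rewrite -{1}ya -(adjP dot_norm) // opB // yf subrr dot0l.
- by exists (y h0); rewrite wyx.
Qed.
End PolarDecomposition.

(** * The orthogonal projection onto a closed subspace and the operators it commutes with *)

Section OrthProj.
Context (R : realType) (H : completeNormedModType R[i]).
Context (dot : {dot H for Num.conj}).
Context (dot_norm : forall x : H, dot x x = `|x| ^+ 2).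
Context (V : set H) (Vs : subspace V).
Local Notation adj := (adj dot).
Local Notation e := (orth_proj dot (closure V)).

Lemma orth_projP (x : H) : closure V (e x) /\ forall y, closure V y -> dot (x - e x) y = 0.
Proof.
have ex := proj_exists dot_norm Vs.
exact: (getPex ex x).
Qed.

Lemma orth_proj_eq x q : closure V q -> (forall y, closure V y -> dot (x - q) y = 0) -> e x = q.
Proof.
move=> Vq qP; have Vd : closure V (e x - q).
  by apply: (subspaceB (closure_subspace Vs)) => //; exact: (orth_projP x).1.
have dd : dot (e x - q) (e x - q) = 0.
  rewrite [X in dot X _](_ : _ = (x - q) - (x - e x)).
    by rewrite dotBl qP // (orth_projP x).2 // subrr.
  by rewrite opprB [RHS]addrC subrKA.
by apply/subr0_eq/eqP; rewrite -(dnorm_eq0 dot); apply/eqP.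
Qed.

Lemma orth_proj_id x : closure V x -> e x = x.
Proof. by move=> Vx; apply: orth_proj_eq => // y _; rewrite subrr dot0l. Qed.

Lemma orth_proj_selfadj x y : dot (e x) y = dot x (e y).
Proof.
have [Vx xP] := orth_projP x; have [Vy yP] := orth_projP y.
rewrite -{1}(subrK (e y) y) -{2}(subrK (e x) x) dotDr dotDl (xP _ Vy) add0r.
by rewrite dotC yP // rmorph0 add0r.
Qed.

Lemma orth_proj_bounded : bounded_op e.
Proof.
apply: (@bounded_intro _ _ _ 1) => [c x y|x].
  apply: orth_proj_eq.
    by apply: (closure_subspace Vs).2; [exact: (orth_projP x).1 | exact: (orth_projP y).1].
  move=> z Vz; rewrite (_ : _ - _ = c *: (x - e x) + (y - e y)).
    by rewrite dotDl dotZl (orth_projP x).2 // (orth_projP y).2 // mulr0 addr0.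
  by rewrite scalerBr opprD addrACA.
rewrite mul1r; apply: nm_le_sq; first exact: nm_ge0.
have h : real_dot dot (x - e x) (e x) = 0.
  by rewrite /real_dot (orth_projP x).2 //; exact: (orth_projP x).1.
have := nm_add_sq dot_norm (x - e x) (e x); rewrite subrK h => ->.
by rewrite mulr0 addr0 lerDr sqr_ge0.
Qed.

Lemma orth_proj_adj : adj e = e.
Proof. by apply: adj_uniq; exact: orth_proj_selfadj. Qed.

Lemma orth_proj_idem x : e (e x) = e x.
Proof. by apply: orth_proj_id; exact: (orth_projP x).1. Qed.

Lemma closure_image a : bounded_op a -> (forall x, V x -> closure V (a x)) ->
  forall x, closure V x -> closure V (a x).
Proof.
move=> ba aV x /closure_nm Vx; apply: closureK; apply/closure_nm => d d0.
have [C C0 aC] := bounded_norm ba; have [y Vy xy] := Vx _ (divr_gt0 d0 C0).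
exists (a y); first exact: aV.
by rewrite -(opB _ _ ba); apply: le_lt_trans (aC _) _; rewrite mulrC -ltr_pdivlMr.
Qed.

(** A subspace invariant under both [a] and its adjoint reduces [a]: its orthogonal complement is
    invariant as well. *)
Lemma orth_proj_comm a : bounded_op a -> (forall x, V x -> closure V (a x)) ->
  (forall x, V x -> closure V (adj a x)) -> forall x, e (a x) = a (e x).
Proof.
move=> ba aV aV' x; have [Vx xP] := orth_projP x.
apply: orth_proj_eq; first exact: closure_image.
move=> y Vy; rewrite -(opB _ _ ba) (adjP dot_norm _ _ ba); apply: xP.
by apply: (closure_image _ aV') => //; exact: (bounded_adj dot_norm ba).
Qed.

End OrthProj.

(** * The standard representation of a tracial von Neumann algebra *)
Section StandardForm.
Context (R : realType) (H : completeNormedModType R[i]).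
Context (dot : {dot H for Num.conj}).
Context (dot_norm : forall x : H, dot x x = `|x| ^+ 2).
Context (M : set (H -> H)) (tau : (H -> H) -> R[i]) (Omega : H).
Context (vM : von_neumann dot M) (tauM : is_tracial_state dot M tau).
Context (L2M : is_L2 dot M tau Omega).
Implicit Types (a b : H -> H) (N : set (H -> H)).
Local Notation adj := (adj dot).
Local Notation rdot := (real_dot dot).
Local Notation orb N := [set a Omega | a in N].

Lemma orb_subspace N : von_neumann dot N -> subspace (orb N).
Proof.
move=> vN; split.
  exists (fun x => 0 *: idfun x); last by rewrite scale0r.
  by apply: (vN_scale vN); exact: (vN_id vN).
move=> c _ _ [a Na <-] [b Nb <-]; exists (fun x => c *: a x + b x) => //.
exact: (vN_lin vN).
Qed.

Lemma dot_tau a b : M a -> M b -> dot (a Omega) (b Omega) = tau (adj b \o a).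
Proof. exact: L2M.1. Qed.

Lemma orbM x : closure (orb M) x.
Proof. by rewrite -/(L2_subspace M Omega) L2M.2. Qed.

(** The trace property in Hilbert space form: a Omega |-> a^* Omega is a conjugate-linear
    isometry. *)
Lemma dot_adj_orb a b : M a -> M b -> dot (adj a Omega) (adj b Omega) = dot (b Omega) (a Omega).
Proof.
move=> Ma Mb; have Ma' := vN_adj vM Ma; have Mb' := vN_adj vM Mb.
rewrite !dot_tau // (adjK dot_norm (vN_bounded vM Mb)).
exact: tau_tracial tauM _ _ Mb Ma'.
Qed.

Lemma nm_adj_orb a : M a -> nm (adj a Omega) = nm (a Omega).
Proof.
move=> Ma; apply/eqP; rewrite -(@eqrXn2 _ 2) ?nm_ge0 //.
by rewrite -!(rdotxx dot_norm) /real_dot dot_adj_orb.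
Qed.

Lemma dotOmega : dot Omega Omega = 1.
Proof.
have Mi := vN_id vM; have := dot_tau Mi Mi.
by rewrite /= adj_id => ->; exact: tau_normalized tauM.
Qed.

Lemma closure_norm_le N z (K : R) : 0 <= K -> closure (orb N) z ->
  (forall c, N c -> rdot z (c Omega) <= K * nm (c Omega)) -> nm z <= K.
Proof.
move=> K0 /closure_nm Nz zK; have [->|z0] := pselect (z = 0); first by rewrite nm0.
have pz := nm_gt0 z0; rewrite -(ler_pM2l pz) -expr2 -(rdotxx dot_norm).
apply/ler_addgt0Pr => e e0; have k0 : 0 < K + nm z by rewrite ltr_wpDl.
have [_ [c Nc <-] zc] := Nz _ (divr_gt0 e0 k0).
have := zK _ Nc; have := cauchy_schwarz dot_norm z (z - c Omega).
have := nm_tri (c Omega) z 0; rewrite !subr0 (nmB (c Omega)).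
rewrite {1}/real_dot dotBr ReD ReN -!/(rdot _ _).
have : e / (K + nm z) * (K + nm z) = e by rewrite divfK // gt_eqF.
move: zc; set d := nm (z - _); set q := e / _; set w := nm (c Omega).
move=> h1 h2 h3 h4 h5; have := ler_wpM2l K0 h3; nra.
Qed.

Lemma dense_norm_le z (K : R) : 0 <= K ->
  (forall c, M c -> rdot z (c Omega) <= K * nm (c Omega)) -> nm z <= K.
Proof. by move=> K0; apply: closure_norm_le => //; exact: orbM. Qed.

Lemma dense_eq0 z : (forall c, M c -> rdot z (c Omega) <= 0) -> z = 0.
Proof.
move=> h; apply/nm_eq0/eqP; rewrite eq_le nm_ge0 andbT; apply: dense_norm_le => // c Mc.
by rewrite mul0r h.
Qed.

Lemma dense_op (S T : H -> H) : bounded_op S -> bounded_op T ->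
  (forall a, M a -> S (a Omega) = T (a Omega)) -> forall x, S x = T x.
Proof.
move=> bS bT ST x; apply/subr0_eq.
apply: (@vanish_subspace _ _ _ dot_norm (fun h => S h - T h) (orb M)).
- have := bounded_lin (-1) bT bS; congr bounded_op.
  by apply/funext => u; rewrite scaleN1r addrC.
- exact: orb_subspace.
- by move=> _ [a Ma <-]; rewrite ST // subrr.
- move=> y yM; have -> : y = 0; last by rewrite (op0 bS) (op0 bT) subrr.
  by apply: dense_eq0 => c Mc; rewrite /real_dot yM //; exists c.
Qed.

Definition rmul (n : H -> H) : H -> H :=
  get [set r | bounded_op r /\ forall a, M a -> r (a Omega) = a (n Omega)].

(** Boundedness comes from the isometry of adjoints: |a n Omega| = |n^* a^* Omega| <= C |a^* Omega|
    = C |a Omega|. *)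
Lemma rmul_spec n : M n -> bounded_op (rmul n) /\
  forall a, M a -> rmul n (a Omega) = a (n Omega).
Proof.
move=> Mn; have Mn' := vN_adj vM Mn.
suff ex : exists r : H -> H, bounded_op r /\ forall a, M a -> r (a Omega) = a (n Omega).
  exact: (getPex ex).
have [C C0 nC] := bounded_norm (vN_bounded vM Mn').
have [|||T [bT _ TG _]] := @bounded_extension _ _ _ dot_norm
  (fun x y => exists a, [/\ M a, x = a Omega & y = a (n Omega)]) C (ltW C0).
- exists (fun x => 0 *: idfun x); split; rewrite ?scale0r //.
  by apply: (vN_scale vM); exact: (vN_id vM).
- move=> c _ _ _ _ [a [Ma -> ->]] [b [Mb -> ->]].
  by exists (fun x => c *: a x + b x); split=> //; exact: (vN_lin vM).
- move=> _ _ [a [Ma -> ->]]; have Ma' := vN_adj vM Ma.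
  rewrite -[a (n _)]/((a \o n) Omega) -nm_adj_orb; last exact: (vN_comp vM).
  rewrite (adj_comp dot_norm (vN_bounded vM Ma) (vN_bounded vM Mn)) /=.
  by rewrite -(nm_adj_orb Ma).
by exists T; split=> // a Ma; apply: TG; exists a.
Qed.

Lemma rmul_bounded n : M n -> bounded_op (rmul n).
Proof. by move=> /rmul_spec[]. Qed.

Lemma rmulE n a : M n -> M a -> rmul n (a Omega) = a (n Omega).
Proof. by move=> /rmul_spec[_ h] /h. Qed.

Lemma rmul_Omega n : M n -> rmul n Omega = n Omega.
Proof. by move=> Mn; exact: (rmulE Mn (vN_id vM)). Qed.

Lemma rmul_comm n m x : M n -> M m -> rmul n (m x) = m (rmul n x).
Proof.
move=> Mn Mm; have br := rmul_bounded Mn; have bm := vN_bounded vM Mm.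
apply: (@dense_op (rmul n \o m) (m \o rmul n)) => [||a Ma].
- exact: bounded_comp.
- exact: bounded_comp.
- rewrite /= -[m (a _)]/((m \o a) Omega) !rmulE //; exact: (vN_comp vM).
Qed.

Lemma rmul_comp n m x : M n -> M m -> rmul n (rmul m x) = rmul (m \o n) x.
Proof.
move=> Mn Mm; have bn := rmul_bounded Mn; have bm := rmul_bounded Mm.
have Mnm : M (m \o n) by exact: (vN_comp vM).
apply: (@dense_op (rmul n \o rmul m) (rmul (m \o n))) => [||a Ma].
- exact: bounded_comp.
- exact: rmul_bounded.
- by rewrite /= !rmulE // -[a (m _)]/((a \o m) Omega) rmulE //; exact: (vN_comp vM).
Qed.

Lemma rmul_id x : rmul idfun x = x.
Proof.
have Mi := vN_id vM.
apply: (@dense_op (rmul idfun) idfun) => [||a Ma]; [exact: rmul_bounded | exact: bounded_id |].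
by rewrite rmulE.
Qed.

Lemma rmul_adj n : M n -> adj (rmul n) = rmul (adj n).
Proof.
move=> Mn; have br := rmul_bounded Mn; have Mn' := vN_adj vM Mn.
apply/funext => x; apply: (@dense_op (adj (rmul n)) (rmul (adj n))) => [||a Ma].
- exact: (bounded_adj dot_norm).
- exact: rmul_bounded.
apply/subr0_eq/dense_eq0 => c Mc; have Mc' := vN_adj vM Mc.
have Mcn : M (c \o n) by exact: (vN_comp vM).
have Man : M (a \o adj n) by exact: (vN_comp vM).
rewrite /real_dot dotBl -(adjPr dot_norm) // !rmulE //.
rewrite -[c (n _)]/((c \o n) Omega) -[a (adj n _)]/((a \o adj n) Omega) !dot_tau //.
rewrite (adj_comp dot_norm (vN_bounded vM Mc) (vN_bounded vM Mn)).
have := tau_tracial tauM Mn' (vN_comp vM Mc' Ma).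
by rewrite /comp => ->; rewrite subrr.
Qed.

(** Omega is separating for M: since a (c Omega) = r_c (a Omega), the vector a Omega determines [a]
    on the dense subspace M Omega. *)
Lemma orb_inj a b : M a -> M b -> a Omega = b Omega -> a = b.
Proof.
move=> Ma Mb ab; apply/funext; apply: dense_op; [exact: (vN_bounded vM)| exact: (vN_bounded vM) |].
by move=> c Mc; rewrite -(rmulE Mc Ma) -(rmulE Mc Mb) ab.
Qed.

(* The map T Omega |-> T^* Omega is isometric on such T, as it is on N. *)
Lemma adj_approx N (T x : H -> H) : von_neumann dot N -> N `<=` M -> bounded_op T ->
  (forall c h, N c -> T (rmul c h) = rmul c (T h)) ->
  closure (orb N) (adj T Omega) -> N x ->
  nm (adj T Omega - adj x Omega) <= nm (T Omega - x Omega).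
Proof.
move=> vN NM bT Tc NT Nx; have Nx' := vN_adj vN Nx.
have bx := vN_bounded vN Nx.
apply: (@closure_norm_le N); first exact: nm_ge0.
  apply: (subspaceB (closure_subspace (orb_subspace vN))) => //.
  by apply: subset_closure; exists (adj x).
move=> c Nc; have Nc' := vN_adj vN Nc; have Mc := NM _ Nc; have Mc' := NM _ Nc'.
have -> : rdot (adj T Omega - adj x Omega) (c Omega) =
    rdot (adj c Omega) (T Omega - x Omega).
  rewrite /real_dot dotBl -(adjPr dot_norm Omega (c Omega) bT) -(adjPr dot_norm Omega (c
    Omega) bx) -{1 2}(rmul_Omega Mc) Tc // -(rmul_comm _ Mc (NM _ Nx)).
  rewrite -dotBr -(opB _ _ (rmul_bounded Mc)) (adjPr dot_norm) //; last exact: rmul_bounded.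
  by rewrite rmul_adj // rmul_Omega.
apply: le_trans (cauchy_schwarz dot_norm _ _) _.
by rewrite nm_adj_orb // mulrC.
Qed.

(** It suffices that [T] commutes with each s in the commutant of N. In the matrix coefficient of T
    s - s T between a Omega and b Omega, [T] may be replaced by an x in N, which commutes with s.
    Right multiplications by a and b bound the cost by |T Omega - x Omega| and |T^* Omega - x^*
    Omega|, and [adj_approx] controls the second by the first. *)
Lemma mem_of_orb N (T : H -> H) : von_neumann dot N -> N `<=` M -> bounded_op T ->
  (forall c h, M c -> T (rmul c h) = rmul c (T h)) -> closure (orb N) (T Omega) -> N T.
Proof.
move=> vN NM bT Tc NT; apply: (vN_intro vN) => // s h Ns; have bs := Ns.1.
apply: (@dense_op (T \o s) (s \o T)) => [||a Ma]; [exact: bounded_comp | exact: bounded_comp |].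
apply/subr0_eq/dense_eq0 => b Mb; apply/ler_addgt0Pr => e e0; rewrite add0r.
have bT' := bounded_adj dot_norm bT; have bs' := bounded_adj dot_norm bs.
have [Ca Ca0 ra] := bounded_norm (rmul_bounded Ma).
have [Cb Cb0 rb] := bounded_norm (rmul_bounded Mb).
set u := s (a Omega); set v := adj s (b Omega).
pose K := nm u * Cb + Ca * nm v + 1.
have K0 : 0 < K.
  by rewrite ltr_wpDl // addr_ge0 // mulr_ge0 ?nm_ge0 // ltW.
have /closure_nm/(_ _ (divr_gt0 e0 K0))[_ [x Nx <-] xe] := NT.
have Mx := NM _ Nx; have bx := vN_bounded vN Nx; have bx' := bounded_adj dot_norm bx.
have h1 := adj_approx vM (fun _ => id) bT Tc (@orbM _) Mx.
have T'c c k : M c -> adj T (rmul c k) = rmul c (adj T k).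
  move=> Mc; have Mc' := vN_adj vM Mc.
  apply: (dot_inj (dot := dot)) => z; have br := rmul_bounded Mc.
  rewrite -(adjPr dot_norm _ _ bT) (adjP dot_norm _ _ br) (rmul_adj Mc) -Tc //.
  by rewrite (adjPr dot_norm _ _ bT) -(rmul_adj Mc) -(adjP dot_norm _ _ br).
have -> : rdot ((T \o s) (a Omega) - (s \o T) (a Omega)) (b Omega) =
    rdot u (rmul b (adj T Omega - adj x Omega)) - rdot (rmul a (T Omega - x Omega)) v.
  have xs := vN_comm (a Omega) Nx Ns.
  have -> : rmul a (T Omega - x Omega) = T (a Omega) - x (a Omega).
    by rewrite (opB _ _ (rmul_bounded Ma)) -Tc // (rmul_comm _ Ma Mx) rmul_Omega.
  have -> : rmul b (adj T Omega - adj x Omega) = adj T (b Omega) - adj x (b Omega).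
    have Mx' := vN_adj vM Mx.
    by rewrite (opB _ _ (rmul_bounded Mb)) -T'c // (rmul_comm _ Mb Mx') rmul_Omega.
  rewrite /v /u /= !rdotE /real_dot.
  rewrite -(adjP dot_norm _ _ bT) -(adjP dot_norm _ _ bx) -!(adjP dot_norm _ _ bs) xs; ring.
have c1 := cauchy_schwarz dot_norm u (rmul b (adj T Omega - adj x Omega)).
have c2 := cauchy_schwarz dot_norm (- rmul a (T Omega - x Omega)) v.
rewrite rdotNl nmN in c2.
have k1 := ler_wpM2l (nm_ge0 u) (rb (adj T Omega - adj x Omega)).
have k2 := ler_wpM2r (nm_ge0 v) (ra (T Omega - x Omega)).
have eK : e / K * K = e by rewrite divfK // gt_eqF.
have k3 : nm u * (Cb * nm (adj T Omega - adj x Omega)) <= nm u * (Cb * (e / K)).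
  by rewrite ler_wpM2l ?nm_ge0 // ler_wpM2l ?(ltW Cb0) // (le_trans h1) // ltW.
have k4 : Ca * nm (T Omega - x Omega) * nm v <= Ca * (e / K) * nm v.
  by rewrite ler_wpM2r ?nm_ge0 // ler_wpM2l ?(ltW Ca0) // ltW.
have : 0 <= e / K by rewrite divr_ge0 // ltW.
rewrite /K in eK k3 k4 *; set q := e / _ in eK k3 k4 *; nra.
Qed.

(* Only real parts are compared, which is all that is needed of the trace property. *)
Lemma trace_of_orb N (X Y : H -> H) : von_neumann dot N -> N `<=` M ->
  bounded_op X -> bounded_op Y ->
  (forall c h, N c -> X (rmul c h) = rmul c (X h)) ->
  (forall c h, N c -> Y (rmul c h) = rmul c (Y h)) ->
  closure (orb N) (X Omega) -> closure (orb N) (Y Omega) ->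
  closure (orb N) (adj X Omega) -> closure (orb N) (adj Y Omega) ->
  rdot (X (Y Omega)) Omega = rdot (Y (X Omega)) Omega.
Proof.
move=> vN NM; suff le X' Y' : bounded_op X' -> bounded_op Y' ->
    (forall c h, N c -> X' (rmul c h) = rmul c (X' h)) ->
    (forall c h, N c -> Y' (rmul c h) = rmul c (Y' h)) ->
    closure (orb N) (X' Omega) -> closure (orb N) (Y' Omega) ->
    closure (orb N) (adj X' Omega) -> closure (orb N) (adj Y' Omega) ->
    rdot (X' (Y' Omega)) Omega <= rdot (Y' (X' Omega)) Omega.
  move=> bX bY Xc Yc NX NY NX' NY'; apply/eqP; rewrite eq_le.
  by rewrite (le _ _ bX bY Xc Yc NX NY NX' NY') (le _ _ bY bX Yc Xc NY NX NY' NX').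
move=> {X Y}bX bY Xc Yc NX NY NX' NY'; set X := X'; set Y := Y'.
have -> : rdot (X (Y Omega)) Omega = rdot (Y Omega) (adj X Omega).
  by rewrite /real_dot (adjP dot_norm).
have -> : rdot (Y (X Omega)) Omega = rdot (X Omega) (adj Y Omega).
  by rewrite /real_dot (adjP dot_norm).
apply/ler_addgt0Pr => e e0.
(* [K] collects four Cauchy-Schwarz errors. The summand 2 comes from |y Omega| <= |Y Omega| + 1 and
   |x Omega| <= |X Omega| + 1, which is why d is kept below 1. *)
pose K := nm (X Omega) + nm (Y Omega) + nm (adj X Omega) + nm (adj Y Omega) + 2.
have pX := nm_ge0 (X Omega); have pY := nm_ge0 (Y Omega).
have pX' := nm_ge0 (adj X Omega); have pY' := nm_ge0 (adj Y Omega).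
have K0 : 0 < K by rewrite /K; lra.
pose d := Num.min 1 (e / K).
have d0 : 0 < d by rewrite lt_min ltr01 divr_gt0.
have d1 : d <= 1 by rewrite ge_min lexx.
have dK : d * K <= e by rewrite -ler_pdivlMr // ge_min lexx orbT.
have /closure_nm/(_ _ d0)[_ [x Nx <-] xd] := NX.
have /closure_nm/(_ _ d0)[_ [y Ny <-] yd] := NY.
have Mx := NM _ Nx; have My := NM _ Ny; have My' := vN_adj vM My.
have xd' := adj_approx vN NM bX Xc NX' Nx.
have yd' := adj_approx vN NM bY Yc NY' Ny.
have xy : rdot (y Omega) (adj x Omega) = rdot (x Omega) (adj y Omega).
  rewrite /real_dot -(dot_adj_orb My' Mx) (adjK dot_norm) //; exact: (vN_bounded vM).
have c1 := cauchy_schwarz dot_norm (Y Omega - y Omega) (adj X Omega).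
have c2 := cauchy_schwarz dot_norm (y Omega) (adj X Omega - adj x Omega).
have c3 := cauchy_schwarz dot_norm (- (X Omega - x Omega)) (adj Y Omega).
have c4 := cauchy_schwarz dot_norm (- x Omega) (adj Y Omega - adj y Omega).
have t1 := nm_tri (y Omega) (Y Omega) 0; have t2 := nm_tri (x Omega) (X Omega) 0.
rewrite !subr0 (nmB (y Omega)) in t1; rewrite !subr0 (nmB (x Omega)) in t2.
rewrite !rdotE ?nmN in c1 c2 c3 c4.
have m1 := ler_wpM2r pX' (ltW yd); have m3 := ler_wpM2r pY' (ltW xd).
have m2 : nm (y Omega) * nm (adj X Omega - adj x Omega) <= (nm (Y Omega) + 1) * d.
  apply: ler_pM; rewrite ?nm_ge0 //; last by rewrite (le_trans xd') // ltW.
  by move: yd d1 t1; rewrite -/Y; lra.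
have m4 : nm (x Omega) * nm (adj Y Omega - adj y Omega) <= (nm (X Omega) + 1) * d.
  apply: ler_pM; rewrite ?nm_ge0 //; last by rewrite (le_trans yd') // ltW.
  by move: xd d1 t2; rewrite -/X; lra.
rewrite /K in dK; nra.
Qed.

(** The bounded extension of a Omega |-> r_a l commutes with all right multiplications, so
    [mem_of_orb], taken with M itself, places it in M. *)
Lemma left_bounded l (K : R) : 0 <= K ->
  (forall a, M a -> nm (rmul a l) <= K * nm (a Omega)) ->
  exists2 L, M L & L Omega = l.
Proof.
move=> K0 lK.
have rlin c a b : M a -> M b ->
    rmul (fun x => c *: a x + b x) l = c *: rmul a l + rmul b l.
  move=> Ma Mb; have Mab : M (fun x => c *: a x + b x) by exact: (vN_lin vM).
  apply: (@dense_op (rmul (fun x => c *: a x + b x)) (fun x => c *: rmul a x + rmul b x)).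
  - exact: rmul_bounded.
  - by apply: bounded_lin; exact: rmul_bounded.
  - move=> m Mm; rewrite (rmulE Mab Mm) (rmulE Ma Mm) (rmulE Mb Mm).
    by rewrite (opD _ _ (vN_bounded vM Mm)) (opZ _ _ (vN_bounded vM Mm)).
have [|||T [bT _ TG _]] := @bounded_extension _ _ _ dot_norm
  (fun x y => exists a, [/\ M a, x = a Omega & y = rmul a l]) K K0.
- have M0 : M (fun x => 0 *: idfun x) by apply: (vN_scale vM); exact: (vN_id vM).
  exists (fun x => 0 *: idfun x); split; rewrite ?scale0r //.
  by apply/esym/nm_eq0/eqP; rewrite eq_le nm_ge0 andbT (le_trans (lK _ M0)) // scale0r nm0 mulr0.
- move=> c _ _ _ _ [a [Ma -> ->]] [b [Mb -> ->]].
  by exists (fun x => c *: a x + b x); rewrite rlin //; split=> //; exact: (vN_lin vM).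
- by move=> _ _ [a [Ma -> ->]]; exact: lK.
have {}TG a : M a -> T (a Omega) = rmul a l by move=> Ma; apply: TG; exists a.
have Mi := vN_id vM; exists T; last by rewrite -[RHS]rmul_id -TG.
apply: mem_of_orb => //; last exact: orbM.
move=> c h Mc; have bc := rmul_bounded Mc.
apply: (@dense_op (T \o rmul c) (rmul c \o T)) => [||a Ma];
  [exact: bounded_comp| exact: bounded_comp|].
rewrite /= rmulE // -[a (c _)]/((a \o c) Omega) !TG //; last exact: (vN_comp vM).
by rewrite rmul_comp.
Qed.

(** This is the substance of M' = J M J, where J a Omega = a^* Omega. The vector s Omega is left
    bounded because <r_a s Omega, c Omega> = <c^* Omega, s^* a^* Omega> and adjoints preserve the
    norm on M Omega. *)
Lemma left_of_commutant s : commutant M s -> exists2 L, M L & L Omega = s Omega.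
Proof.
move=> Ms; have bs := Ms.1; have bs' := bounded_adj dot_norm bs.
have Ms' := commutant_vN_adj dot_norm vM Ms.
have [C C0 sC] := bounded_norm bs'.
apply: (@left_bounded _ C (ltW C0)) => a Ma; have Ma' := vN_adj vM Ma.
apply: dense_norm_le; first by rewrite mulr_ge0 ?nm_ge0 // ltW.
move=> c Mc; have Mc' := vN_adj vM Mc.
have -> : rdot (rmul a (s Omega)) (c Omega) = rdot (adj c Omega) (adj s (adj a Omega)).
  rewrite /real_dot (adjP dot_norm _ _ (rmul_bounded Ma)) (rmul_adj Ma) rmulE //.
  rewrite (adjPr dot_norm _ _ (vN_bounded vM Mc)) (vN_comm _ Mc' Ms).
  by rewrite (adjP dot_norm _ _ bs).
apply: le_trans (cauchy_schwarz dot_norm _ _) _.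
rewrite mulrC; apply: ler_pM; rewrite ?nm_ge0 //; last by rewrite nm_adj_orb.
by rewrite -(nm_adj_orb Ma).
Qed.

End StandardForm.

(** * Consequences of irreducibility: central vector states and the joint commutant *)

Section Irreducible.
Context (R : realType) (H : completeNormedModType R[i]).
Context (dot : {dot H for Num.conj}).
Context (dot_norm : forall x : H, dot x x = `|x| ^+ 2).
Context (M : set (H -> H)) (tau : (H -> H) -> R[i]) (Omega : H).
Context (vM : von_neumann dot M) (tauM : is_tracial_state dot M tau).
Context (L2M : is_L2 dot M tau Omega).
Context (N : set (H -> H)) (vN : von_neumann dot N) (NM : N `<=` M).
Context (irr : commutant N `&` M = scalars).
Implicit Types (a b : H -> H).
Local Notation adj := (adj dot).
Local Notation rdot := (real_dot dot).
Local Notation rmul := (rmul M Omega).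
Local Notation orb N := [set a Omega | a in N].
Local Notation rmulE := (rmulE dot_norm vM tauM L2M).
Local Notation rmul_Omega := (rmul_Omega dot_norm vM tauM L2M).
Local Notation rmul_bounded := (rmul_bounded dot_norm vM tauM L2M).
Local Notation rmul_comm := (rmul_comm dot_norm vM tauM L2M).
Local Notation rmul_comp := (rmul_comp dot_norm vM tauM L2M).
Local Notation rmul_adj := (rmul_adj dot_norm vM tauM L2M).
Local Notation rmul_id := (rmul_id dot_norm vM tauM L2M).

Lemma irr_scalar (L : H -> H) : M L -> (forall n x, N n -> L (n x) = n (L x)) ->
  exists c : R[i], forall x, L x = c *: x.
Proof.
move=> ML LN; have : (commutant N `&` M) L.
  by split=> //; apply/commutantP; split; [exact: (vN_bounded vM) | move=> s x; exact: LN].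
by rewrite irr => -[c ->]; exists c.
Qed.

Lemma nm_scale (r : R) (x : H) : 0 <= r -> nm (r%:C%C *: x) = r * nm x.
Proof. by move=> r0; rewrite nmZ ger0_norm // lecR. Qed.

Lemma unitary_dot (w : H -> H) x y : unitary_op dot w -> dot (w x) (w y) = dot x y.
Proof.
move=> [bw w1 _]; rewrite (adjP dot_norm _ _ bw).
by have := congr1 (@^~ y) w1 => /= ->.
Qed.

Lemma unitary_nm (w : H -> H) x : unitary_op dot w -> nm (w x) = nm x.
Proof.
move=> uw; apply/eqP; rewrite -(@eqrXn2 _ 2) ?nm_ge0 //.
by rewrite -!(rdotxx dot_norm) /real_dot unitary_dot.
Qed.

Lemma unitary_adj (w : H -> H) : unitary_op dot w -> unitary_op dot (adj w).
Proof.
by move=> [bw w1 w2]; split; [exact: (bounded_adj dot_norm) | |]; rewrite (adjK dot_norm bw).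
Qed.

Lemma rmul_unitary (w : H -> H) : M w -> unitary_op dot w -> unitary_op dot (rmul w).
Proof.
move=> Mw [bw w1 w2]; have Mw' := vN_adj vM Mw.
split; first exact: rmul_bounded.
  by rewrite rmul_adj //; apply/funext => x /=; rewrite rmul_comp // w2 rmul_id.
by rewrite rmul_adj //; apply/funext => x /=; rewrite rmul_comp // w1 rmul_id.
Qed.

(* The set V below is stable under averaging over the unitaries of N, so its
   element of least norm is a scalar multiple of Omega by irreducibility. *)
Lemma central_vector_state (xi : H) :
  (forall a n, M a -> N n -> rdot (a (n xi)) xi = rdot (n (a xi)) xi) ->
  forall x, M x -> rdot (x xi) xi = nm xi ^+ 2 * rdot (x Omega) Omega.
Proof.
move=> xiN x Mx; have [K K0 xK] := bounded_norm (vN_bounded vM Mx).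
(* Each condition is convex and stable under y |-> w y w^* for unitaries w of N: the value at [xi]
   by centrality, the value at Omega because right multiplication by w^* is unitary. *)
pose S := [set y | [/\ M y, norm_bound K y, rdot (y xi) xi = rdot (x xi) xi &
  rdot (y Omega) Omega = rdot (x Omega) Omega]].
have [||l /closure_nm Vl lmin] := @min_norm _ _ _ dot_norm [set y Omega | y in S].
- by exists (x Omega), x.
- move=> _ _ [y [My yK y1 y2] <-] [z [Mz zK z1 z2] <-].
  have h0 : 0 <= 2^-1 :> R by rewrite invr_ge0.
  exists (fun u => (2^-1)%:C%C *: y u + (2^-1)%:C%C *: z u); last by rewrite scalerDr.
  split.
  + by apply: (vN_lin vM) => //; exact: (vN_scale vM).
  + move=> u; apply: le_trans (nmD _ _) _; rewrite !nm_scale //.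
    have := yK u; have := zK u; lra.
  + by rewrite !rdotE y1 z1; lra.
  + by rewrite !rdotE y2 z2; lra.
(* As r_a (y Omega) = y (a Omega), the common bound [K] on [S] makes the minimizer a left bounded
   vector, hence of the form L Omega with L in M. *)
have lr a : M a -> nm (rmul a l) <= K * nm (a Omega).
  move=> Ma; apply/ler_addgt0Pr => e e0; have [C C0 aC] := bounded_norm (rmul_bounded Ma).
  have [_ [y [My yK _ _] <-] ly] := Vl _ (divr_gt0 e0 C0).
  have := nm_tri (rmul a l) (rmul a (y Omega)) 0; rewrite !subr0 -(opB _ _ (rmul_bounded Ma)).
  rewrite (rmul_comm _ Ma My) rmul_Omega // addrC => /le_trans; apply; apply: lerD; first exact: yK.
  by apply: le_trans (aC _) _; rewrite mulrC -ler_pdivlMr // ltW.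
have [L ML LO] := left_bounded dot_norm vM tauM L2M (ltW K0) lr.
have bL := vN_bounded vM ML.
(* [U] sends y Omega to w y w^* Omega, so it is an isometry preserving the convex set. It maps
   near-minimizers to near-minimizers, and all of these are close to [l]; hence U l = l. *)
have winv w : N w -> unitary_op dot w -> w (rmul (adj w) l) = l.
  move=> Nw uw; have uw' := unitary_adj uw; have Nw' := vN_adj vN Nw.
  have Mw := NM Nw; have Mw' := NM Nw'; have bw := vN_bounded vM Mw.
  have urw := rmul_unitary Mw' uw'.
  set U := fun h => w (rmul (adj w) h).
  have Unm h : nm (U h) = nm h by rewrite /U unitary_nm // unitary_nm.
  have UB h k : U (h - k) = U h - U k by rewrite /U (opB _ _ (rmul_bounded Mw')) (opB _ _ bw).
  have US y : S y -> [set y Omega | y in S] (U (y Omega)).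
    move=> [My yK y1 y2]; exists (w \o (y \o adj w)); last first.
      by rewrite /U rmulE //.
    have w1 h : adj w (w h) = h by have [_ /(congr1 (@^~ h))] := uw.
    split.
    - by apply: (vN_comp vM) => //; exact: (vN_comp vM).
    - by move=> h /=; rewrite unitary_nm // (le_trans (yK _)) // unitary_nm.
    - have := xiN (y \o adj w) w (vN_comp vM My Mw') Nw; rewrite /= w1 => <-; exact: y1.
    - rewrite -y2 /real_dot /= (adjP dot_norm _ _ bw) -(rmulE Mw' My).
      by rewrite -(rmul_Omega Mw') (unitary_dot _ _ urw).
  have Uclose y : S y -> nm (U l - l) <= nm (y Omega - l) + nm (U (y Omega) - l).
    by move=> Sy; have := nm_tri (U l) (U (y Omega)) l; rewrite -UB Unm (nmB l).
  apply/subr0_eq/nm_eq0/eqP; rewrite -sqrf_eq0 eq_le sqr_ge0 andbT.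
  rewrite -/(U l); apply/ler_addgt0Pr => e e0; rewrite add0r.
  (* With |y Omega| <= d + |l| and d <= 1, the minimizing estimate gives q^2 <= 4 (d^2 + 2 d |l|) <=
     4 d (1 + 2 |l|). Then u^2 <= 2 p^2 + 2 q^2 <= d (10 + 16 |l|). *)
  have pl := nm_ge0 l; pose k := 10 + 16 * nm l.
  have k0 : 0 < k by rewrite /k; lra.
  pose d := Num.min 1 (e / k).
  have d0 : 0 < d by rewrite lt_min ltr01 divr_gt0.
  have d1 : d <= 1 by rewrite ge_min lexx.
  have dk : d * k <= e by rewrite -ler_pdivlMr // ge_min lexx orbT.
  have [_ [y Sy <-] ly] := Vl _ d0; rewrite nmB in ly.
  have := Uclose _ Sy; have := lmin _ (US _ Sy); rewrite Unm.
  have := nm_tri (y Omega) l 0; rewrite !subr0.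
  move: ly; set p := nm (y Omega - l); set q := nm (U (y Omega) - l); set r := nm (y Omega).
  have p0 : 0 <= p := nm_ge0 _; have q0 : 0 <= q := nm_ge0 _; have r0 : 0 <= r := nm_ge0 _.
  have u0 := nm_ge0 (U l - l); set u := nm (U l - l) in u0 *.
  move=> h1 h2 h3 h4.
  have h5 : r ^+ 2 <= (d + nm l) ^+ 2 by rewrite ler_sqr ?nnegrE //; lra.
  have h6 : u ^+ 2 <= (p + q) ^+ 2 by rewrite ler_sqr ?nnegrE //; lra.
  have h7 : p ^+ 2 <= d ^+ 2 by rewrite ler_sqr ?nnegrE //; lra.
  have h8 : d ^+ 2 <= d by rewrite expr2 ler_piMr // ltW.
  have h9 : (p + q) ^+ 2 <= 2 * p ^+ 2 + 2 * q ^+ 2 by have := sqr_ge0 (p - q); nra.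
  rewrite /k in dk; nra.
have LN : forall n u, N n -> L (n u) = n (L u).
  apply: (commute_unitaries dot_norm vN bL) => w Nw uw u.
  have Mw := NM Nw; have bw := vN_bounded vM Mw; have Mw' := vN_adj vM Mw.
  suff : L \o w = w \o L by move=> /(congr1 (@^~ u)).
  apply: (orb_inj dot_norm vM tauM L2M); [exact: (vN_comp vM) | exact: (vN_comp vM) |].
  rewrite /= -(rmulE Mw ML) LO -{1}(winv _ Nw uw) rmul_comm // rmul_comp //.
  have [_ -> _] := uw; rewrite rmul_id //.
have [c Lc] := irr_scalar ML LN.
have lc : l = c *: Omega by rewrite -LO Lc.
have rO : rdot Omega Omega = 1 by rewrite /real_dot (dotOmega vM tauM L2M).
pose t := complex.Re c.
have rc z : rdot (c *: z) z = t * nm z ^+ 2.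
  rewrite /real_dot dotZl (dotxx dot_norm) mulrC ReZ mulrC //.
have eps_eq (p q : R) : (forall e, 0 < e -> `|p - q| <= e) -> p = q.
  move=> h; apply/eqP; rewrite -subr_eq0 -normr_le0; apply/ler_addgt0Pr => e e0.
  by rewrite add0r h.
have O1 : nm Omega = 1.
  by apply/eqP; rewrite -(@eqrXn2 _ 2) ?nm_ge0 // expr1n -(rdotxx dot_norm) rO.
have -> : rdot (x Omega) Omega = t.
  apply: eps_eq => e e0; have [_ [y [_ _ _ <-] <-] ly] := Vl _ e0.
  have -> : t = rdot l Omega by rewrite lc rc O1 expr1n mulr1.
  rewrite -rdotNl -rdotDl; apply: le_trans (rdot_abs dot_norm _ _) _.
  by rewrite O1 mulr1 nmB ltW.
rewrite mulrC -rc; apply: eps_eq => e e0.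
have c0 : 0 <= complex.Re `|c| by have := normr_ge0 c; rewrite lecE => /andP[].
have px := nm_ge0 xi; pose D := 2 * (K + complex.Re `|c|) * (nm xi + 1).
have D0 : 0 < D by rewrite mulr_gt0 ?mulr_gt0 //; lra.
have /closure_nm/(_ _ (divr_gt0 e0 D0))[_ [b Mb <-] xb] := @orbM _ _ _ _ _ _ L2M xi.
have [C C0 bC] := bounded_norm (rmul_bounded Mb).
have E0 : 0 < 2 * C * (nm xi + 1) by rewrite mulr_gt0 ?mulr_gt0 //; lra.
have [_ [y [My yK <- _] <-] ly] := Vl _ (divr_gt0 e0 E0).
have by_ := vN_bounded vM My.
rewrite -rdotNl -rdotDl; apply: le_trans (rdot_abs dot_norm _ _) _.
(* The vector y Omega is close to c Omega, but the claim concerns [xi]. So [xi] is replaced by b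
   Omega, at a cost bounded by K + |c|, and r_b carries the estimate from Omega to b Omega. The
   choice of [y] comes after that of [b] because its precision depends on the norm of r_b. *)
have -> : y xi - c *: xi = y (xi - b Omega) + rmul b (y Omega - l) + c *: (b Omega - xi).
  rewrite (opB _ _ by_) (opB _ _ (rmul_bounded Mb)) (rmulE Mb My) lc.
  by rewrite (opZ _ _ (rmul_bounded Mb)) rmul_Omega // scalerBr subrKA addrA subrK.
have := nmD (y (xi - b Omega) + rmul b (y Omega - l)) (c *: (b Omega - xi)).
have := nmD (y (xi - b Omega)) (rmul b (y Omega - l)).
rewrite nmZ (nmB (b Omega)); have := yK (xi - b Omega); have := bC (y Omega - l).
rewrite (nmB (y Omega)); move: xb ly.
set d1 := nm (xi - _); set d2 := nm (l - _); set u := nm (_ + _ + _); set v := nm (_ + _).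
set w1 := nm (y _); set w2 := nm (rmul b _).
rewrite !ltr_pdivlMr // => h1 h2 h3 h4 h5 h6.
have u_le : u <= (K + complex.Re `|c|) * d1 + C * d2 by lra.
apply: le_trans (ler_wpM2r px u_le) _.
have q1 : 0 <= d1 := nm_ge0 _; have q2 : 0 <= d2 := nm_ge0 _.
have k1 : (K + complex.Re `|c|) * d1 * nm xi <= (K + complex.Re `|c|) * d1 * (nm xi + 1).
  by rewrite ler_wpM2l ?lerDl // mulr_ge0 //; lra.
have k2 : C * d2 * nm xi <= C * d2 * (nm xi + 1).
  by rewrite ler_wpM2l ?lerDl // mulr_ge0 //; lra.
have e1 : d1 * D = 2 * ((K + complex.Re `|c|) * d1 * (nm xi + 1)) by rewrite /D; ring.
have e2 : d2 * (2 * C * (nm xi + 1)) = 2 * (C * d2 * (nm xi + 1)) by ring.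
rewrite mulrDl; lra.
Qed.

(** Write z Omega = L Omega with L in M. The closure condition puts L in N, and L n Omega = r_n z
    Omega = z n Omega = n z Omega = n L Omega shows that L commutes with N, so L is a scalar by
    irreducibility. As [z] commutes with M, it is the same scalar. *)
Lemma joint_commutant_scalar (z : H -> H) : commutant M z ->
  (forall n h, N n -> z (rmul n h) = rmul n (z h)) -> closure (orb N) (z Omega) ->
  exists c : R[i], forall x, z x = c *: x.
Proof.
move=> Mz zr zO; have [L ML LO] := left_of_commutant dot_norm vM tauM L2M Mz.
have bL := vN_bounded vM ML.
have NL : N L.
  apply: (mem_of_orb dot_norm vM tauM L2M) => //; last by rewrite LO.
  by move=> c h Mc; rewrite rmul_comm.
have [c Lc] : exists c : R[i], forall x, L x = c *: x.
  apply: irr_scalar => // n x Nn; have Mn := NM Nn.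
  suff : L \o n = n \o L by move=> /(congr1 (@^~ x)).
  apply: (orb_inj dot_norm vM tauM L2M); [exact: (vN_comp vM) | exact: (vN_comp vM) |].
  rewrite /= -(rmulE Mn ML) LO -zr // rmul_Omega //.
  by rewrite -(vN_comm _ Mn Mz).
exists c; apply: (dense_op dot_norm vM L2M); [exact: Mz.1 | |].
  by apply: (bounded_scale c); exact: bounded_id.
by move=> a Ma; rewrite -(vN_comm _ Ma Mz) -LO Lc (opZ _ _ (vN_bounded vM Ma)).
Qed.

End Irreducible.

(** * Comparison of projections in a factor *)
Section Comparison.
Context (R : realType) (H : completeNormedModType R[i]).
Context (dot : {dot H for Num.conj}).
Context (dot_norm : forall x : H, dot x x = `|x| ^+ 2).
Context (A : set (H -> H)) (vA : von_neumann dot A).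
Context (factorA : forall z : H -> H, A z -> commutant A z -> exists c : R[i], forall x, z
  x = c *: x).
Context (e f : H -> H) (Ae : A e) (Af : A f).
Context (pe : projection_op dot e) (pf : projection_op dot f).
Local Notation adj := (adj dot).
Local Notation rdot := (real_dot dot).

Let eJ : adj e = e. Proof. by case: pe. Qed.
Let fJ : adj f = f. Proof. by case: pf. Qed.
Let ee x : e (e x) = e x. Proof. by case: pe => _ _ /(congr1 (@^~ x)). Qed.
Let ff x : f (f x) = f x. Proof. by case: pf => _ _ /(congr1 (@^~ x)). Qed.

(** Partial isometries of [A] whose initial projection lies under [f] and whose final projection
    lies under [e]. *)
Definition subiso (v : H -> H) := [/\ A v, forall x, v (adj v (v x)) = v x,
  forall x, e (v x) = v x & forall x, v (f x) = v x].

(* The second clause follows from the first; stating it makes transitivity immediate. *)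
Definition extends (v w : H -> H) :=
  (forall x, w (adj v (v x)) = v x) /\
  (forall x, adj w (w (adj v (v x))) = adj v (v x)).

Lemma adj_comp_eq (a b c : H -> H) : bounded_op a -> bounded_op b -> bounded_op c ->
  (forall x, a (b x) = c x) -> forall x, adj b (adj a x) = adj c x.
Proof.
move=> ba bb bc abc x; apply: (dot_inj (dot := dot)) => z.
by rewrite -!(adjPr dot_norm) // abc.
Qed.

Lemma subiso_adj v : subiso v -> [/\ bounded_op v, bounded_op (adj v),
  forall x, adj v (v (adj v x)) = adj v x,
  forall x, adj v (e x) = adj v x & forall x, f (adj v x) = adj v x].
Proof.
move=> [Av vvv ev vf]; have bv := vN_bounded vA Av; have bv' := bounded_adj dot_norm bv.
have be := vN_bounded vA Ae; have bf := vN_bounded vA Af.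
split=> // x.
- rewrite -{3}(adjK dot_norm bv) -/((adj v \o v) (adj v x)).
  have := @adj_comp_eq v (adj v \o v) v bv (bounded_comp bv' bv) bv vvv x.
  by rewrite (adj_comp dot_norm) // (adjK dot_norm).
- by rewrite -{1}eJ; exact: (adj_comp_eq be bv bv ev).
- by rewrite -{1}fJ; exact: (adj_comp_eq bv bf bv vf).
Qed.

Lemma extends_refl v : subiso v -> extends v v.
Proof.
move=> iv; have [_ vvv _ _] := iv; have [_ _ h _ _] := subiso_adj iv.
by split=> x //; rewrite vvv.
Qed.

Lemma extends_trans v w u : extends v w -> extends w u -> extends v u.
Proof.
move=> [wv wv'] [uw uw']; split=> x.
  by rewrite -(wv' x) uw wv.
by rewrite -(wv' x) uw'.
Qed.

(** Pythagoras: w^* w fixes the initial space of [v], so <w x, v x> = |v x|^2 and w x - v x is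
    orthogonal to v x. This turns monotone convergence of norms into convergence of vectors. *)
Lemma extends_dist v w x : subiso v -> subiso w -> extends v w ->
  nm (w x - v x) ^+ 2 = nm (w x) ^+ 2 - nm (v x) ^+ 2.
Proof.
move=> iv iw [wv wv']; have [bv bv' _ _ _] := subiso_adj iv; have [bw bw' _ _ _] := subiso_adj iw.
have wv2 : rdot (w x) (v x) = nm (v x) ^+ 2.
  by rewrite -(rdotxx dot_norm) -{1}wv /real_dot (adjP dot_norm _ _ bw) wv' -(adjP dot_norm _ _ bv).
by rewrite -!(rdotxx dot_norm) !rdotE (rdotC dot (v x)) wv2 !(rdotxx dot_norm); ring.
Qed.

Lemma subiso_norm v x : subiso v -> nm (v x) <= nm x.
Proof.
move=> iv; have [_ vvv _ _] := iv; have [bv bv' _ _ _] := subiso_adj iv.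
have h : rdot x (adj v (v x)) = nm (v x) ^+ 2.
  by rewrite /real_dot -(adjP dot_norm _ _ bv) -(rdotxx dot_norm).
have h2 : nm (adj v (v x)) ^+ 2 = nm (v x) ^+ 2.
  by rewrite -!(rdotxx dot_norm) /real_dot -(adjP dot_norm _ _ bv) vvv.
apply: nm_le_sq; first exact: nm_ge0.
have := sqr_ge0 (nm (x - adj v (v x))).
by rewrite -(rdotxx dot_norm (x - _)) !rdotE (rdotC dot (adj v _)) h !(rdotxx dot_norm) h2; lra.
Qed.

(** The bound is the strong limit along the tails of the chain: |v x|^2 increases and stays below
    |x|^2, so by [extends_dist] the vectors v x form a Cauchy family. *)
Lemma chain_bound (C : set {v | subiso v}) :
  total_on C (fun v w => `[< extends (sval v) (sval w) >]) -> C !=set0 ->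
  exists w, subiso w /\ forall v, C v -> extends (sval v) w.
Proof.
move=> Ctot [v0 Cv0]; pose T : Type := sig subiso.
pose F : set_system T := filter_from C (fun v => [set w | C w /\ extends (sval v) (sval w)]).
have FF : ProperFilter F.
  apply: filter_from_proper; last first.
    by move=> v Cv; exists v; split=> //; apply: extends_refl; exact: svalP.
  apply: filter_from_filter; first by exists v0.
  move=> v w Cv Cw; have [/asboolP vw|/asboolP wv] := Ctot _ _ Cv Cw.
    exists w => // u [Cu wu]; split; split=> //; exact: extends_trans wu.
  exists v => // u [Cu vu]; split; split=> //; exact: extends_trans vu.
have Fext v : C v -> \forall w \near F, extends (sval v) (sval w).
  by move=> Cv; exists v => // w [].
have [W Wlim] : exists W : H -> H, forall x, sval v x @[v --> F] --> W x.
  suff ex (x : H) : exists y : H, sval v x @[v --> F] --> y by have [W WP] := choice ex; exists W.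
  pose Q := [set nm (sval v x) ^+ 2 | v in C].
  have Q0 : has_sup Q.
    split; first by exists (nm (sval v0 x) ^+ 2), v0.
    exists (nm x ^+ 2) => _ [v Cv <-]; rewrite ler_sqr ?nnegrE ?nm_ge0 //.
    by apply: subiso_norm; exact: svalP.
  pose s := sup Q.
  have vs v : C v -> nm (sval v x) ^+ 2 <= s.
    by move=> Cv; apply: ub_le_sup; [exact: Q0.2 | exists v].
  pose P d y := exists v, [/\ C v, y = sval v x & s - nm (sval v x) ^+ 2 <= d ^+ 2].
  have near d : 0 < d -> exists v, C v /\ s - nm (sval v x) ^+ 2 <= d ^+ 2.
    move=> d0; have d2 : 0 < d ^+ 2 by rewrite exprn_gt0.
    by have [_ [v Cv <-] h] := sup_adherent d2 Q0; exists v; split=> //; rewrite -/s in h; lra.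
  have [] := @complete_nested _ _ P.
  - by move=> d d0; have [v [Cv h]] := near _ d0; exists (sval v x), v.
  - move=> d d' y d0 dd' [v [Cv -> h]]; exists v; split=> //; apply: le_trans h _.
    by rewrite ler_sqr ?nnegrE // ltW // (lt_le_trans d0).
  - move=> d _ _ d0 [v [Cv -> hv]] [w [Cw -> hw]]; apply: nm_le_sq (ltW d0) _.
    have := vs _ Cv; have := vs _ Cw; have [/asboolP vw|/asboolP wv] := Ctot _ _ Cv Cw.
      by rewrite nmB (extends_dist _ (svalP v) (svalP w) vw); lra.
    by rewrite (extends_dist _ (svalP w) (svalP v) wv); lra.
  move=> l lP; exists l; apply: cvg_nm => d d0; have [v [Cv hv]] := near _ d0.
  exists v => // w [Cw vw]; apply: lP => //; exists w; split=> //; apply: le_trans hv.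
  have := extends_dist x (svalP v) (svalP w) vw.
  by have := sqr_ge0 (nm (sval w x - sval v x)); lra.
have Wuniq x l : sval v x @[v --> F] --> l -> W x = l.
  by move=> hl; apply: (@cvg_unique _ (@norm_hausdorff _ H) _ _ _ _ (Wlim x) hl).
have bT (v : T) : bounded_op (sval v) by have [] := subiso_adj (svalP v).
have Wlin : linear W.
  move=> c x y; apply: Wuniq.
  have -> : (fun v : T => sval v (c *: x + y)) = fun v => c *: sval v x + sval v y.
    by apply/funext => v; rewrite (proj1 (bT v)).
  by apply: cvgD; [apply: cvgZr|]; exact: Wlim.
have W1 : norm_bound 1 W.
  move=> x; rewrite mul1r; apply/ler_addgt0Pr => d d0.
  have d0' : 0 < (d%:C%C : R[i]) by rewrite ltcR.
  have /cvgrPdist_le/(_ _ d0') := Wlim x.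
  move=> [v Cv /(_ v)]; rewrite nmE lecR => h.
  have {}h : nm (W x - sval v x) <= d by apply: h; split=> //; apply: extends_refl; exact: svalP.
  have := nm_tri (W x) (sval v x) 0; have := subiso_norm x (svalP v); rewrite !subr0; lra.
have bW : bounded_op W := bounded_intro Wlin W1.
have bW' := bounded_adj dot_norm bW.
have cvg_op (a : H -> H) (u : T -> H) l : bounded_op a -> u v @[v --> F] --> l ->
    a (u v) @[v --> F] --> a l.
  by move=> ba ul; apply: continuous_cvg => //; exact: ba.2.
have Wp v x : C v -> W (adj (sval v) (sval v x)) = sval v x.
  move=> Cv; apply: Wuniq; apply: cvg_nm => d d0; apply: filterS (Fext _ Cv) => w [wv _].
  by rewrite wv subrr nm0 ltW.
(* For a contraction, |W p| = |p| implies W^* W p = p, by expanding |W^* W p - p|^2. *)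
have WWp v x : C v -> adj W (W (adj (sval v) (sval v x))) = adj (sval v) (sval v x).
  move=> Cv; set p := adj (sval v) _; apply/subr0_eq/nm_eq0/eqP;
    rewrite -sqrf_eq0 eq_le sqr_ge0 andbT.
  have pn : nm (W p) ^+ 2 = nm p ^+ 2.
    have [_ vvv _ _] := svalP v.
    by rewrite /p Wp // -!(rdotxx dot_norm) /real_dot -(adjP dot_norm _ _ (bT v)) vvv.
  have WW := norm_bound_adj dot_norm bW ler01 W1 (W p); rewrite mul1r in WW.
  have h : rdot (adj W (W p)) p = nm (W p) ^+ 2.
    by rewrite /real_dot -(adjPr dot_norm _ _ bW) -(rdotxx dot_norm).
  rewrite -(rdotxx dot_norm (_ - _)) !rdotE (rdotC dot p) h !(rdotxx dot_norm).
  have : nm (adj W (W p)) ^+ 2 <= nm (W p) ^+ 2 by rewrite ler_sqr ?nnegrE ?nm_ge0.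
  by rewrite -pn; lra.
have Wv v x : C v -> adj W (sval v x) = adj (sval v) (sval v x).
  by move=> Cv; rewrite -WWp // Wp.
(* Adjoints need not converge strongly. The identity W^* v = v^* v for v in the chain still makes
   the initial projections converge to W^* W. *)
have plim x : adj (sval v) (sval v x) @[v --> F] --> adj W (W x).
  have := cvg_op _ _ _ bW' (Wlim x).
  apply: cvg_trans; apply: near_eq_cvg; exists v0 => // v [Cv _].
  by rewrite /= Wv.
exists W; split; last by move=> v Cv; split=> x; [exact: Wp | exact: WWp].
split.
- apply: (vN_intro vA) => // s x As; apply: Wuniq.
  have -> : (fun v : T => sval v (s x)) = fun v => s (sval v x).
    by apply/funext => v; have [Av _ _ _] := svalP v; rewrite (vN_comm _ Av As).
  by apply: cvg_op; [exact: As.1 | exact: Wlim].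
- move=> x; apply/esym/Wuniq.
  have := cvg_op _ _ _ bW (plim x).
  apply: cvg_trans; apply: near_eq_cvg; exists v0 => // v [Cv _].
  by rewrite /= Wp.
- move=> x; apply/esym/Wuniq; have := cvg_op _ _ _ (vN_bounded vA Ae) (Wlim x).
  apply: cvg_trans; apply: near_eq_cvg; apply: nearW => v.
  by have [_ _ -> _] := svalP v.
- move=> x; apply/Wuniq; have := Wlim x.
  apply: cvg_trans; apply: near_eq_cvg; apply: nearW => v.
  by have [_ _ _ ->] := svalP v.
Qed.

(* Otherwise the projection onto { h | a A h = 0 } is central, hence 0 or 1. *)
Lemma factor_connect (a b : H -> H) : A a -> A b -> (exists x, a x <> 0) ->
  (exists x, b x <> 0) -> exists2 y, A y & exists x, a (y (b x)) <> 0.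
Proof.
move=> Aa Ab [x1 ax1] [x0 bx0]; apply: contrapT => none.
have ayb y x : A y -> a (y (b x)) = 0.
  by move=> Ay; apply: contrapT => h; apply: none; exists y => //; exists x.
have ba := vN_bounded vA Aa; pose V := [set h | forall y, A y -> a (y h) = 0].
have Vs : subspace V.
  split=> [y Ay|c h k Vh Vk y Ay]; have by_ := vN_bounded vA Ay.
    by rewrite (op0 by_) (op0 ba).
  by rewrite (opD _ _ by_) (opZ _ _ by_) (opD _ _ ba) (opZ _ _ ba) Vh // Vk // scaler0 addr0.
have VA s h : A s -> V h -> V (s h).
  by move=> As Vh y Ay; apply: (Vh (y \o s)); exact: (vN_comp vA).
have VA' s h : commutant A s -> V h -> V (s h).
  move=> As Vh y Ay; rewrite (vN_comm _ Ay As) (vN_comm _ Aa As) Vh //.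
  exact: op0 As.1.
pose z := orth_proj dot (closure V).
have bz : bounded_op z by exact: orth_proj_bounded.
have Az : A z.
  apply: (vN_intro vA) => // s x As.
  apply: (orth_proj_comm dot_norm Vs); first exact: As.1.
    by move=> h Vh; apply: subset_closure; exact: VA'.
  by move=> h Vh; apply: subset_closure; apply: VA' => //; exact: (commutant_vN_adj dot_norm vA).
have A'z : commutant A z.
  apply/commutantP; split=> // s x As.
  apply: (orth_proj_comm dot_norm Vs); first exact: (vN_bounded vA).
    by move=> h Vh; apply: subset_closure; exact: VA.
  by move=> h Vh; apply: subset_closure; apply: VA => //; exact: (vN_adj vA).
have [c zc] := factorA Az A'z.
have zb : z (b x0) = b x0.
  by apply: (orth_proj_id dot_norm Vs); apply: subset_closure => y Ay; exact: ayb.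
have c1 : c = 1.
  have /eqP : (c - 1) *: b x0 = 0 by rewrite scalerBl -zc zb scale1r subrr.
  rewrite scaler_eq0 => /orP[|/eqP//]; by rewrite subr_eq0 => /eqP.
apply: ax1; apply: (vanish_closure ba (D := V)).
  by move=> h /(_ _ (vN_id vA)).
by rewrite -[x1]scale1r -c1 -zc; exact: (orth_projP dot_norm Vs x1).1.
Qed.

Lemma isom_of_idem (w : H -> H) : bounded_op w ->
  (forall x, adj w (w (adj w (w x))) = adj w (w x)) -> forall x, w (adj w (w x)) = w x.
Proof.
move=> bw h x; have bw' := bounded_adj dot_norm bw; apply/subr0_eq/nm_eq0/eqP.
rewrite -sqrf_eq0 -(rdotxx dot_norm) /real_dot -(opB _ _ bw) (adjP dot_norm _ _ bw).
by rewrite (opB _ _ bw) (opB _ _ bw') h subrr dot0r.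
Qed.

(** The remainders e - v v^* and f - v^* v are non-zero, so factoriality provides y with e0 y f0
    non-zero. The polar part w of this operator, rescaled to a contraction, has initial and final
    spaces orthogonal to those of [v]; hence v + w is a partial isometry strictly extending [v]. *)
Lemma subiso_extend v : subiso v -> (exists x, e x <> v (adj v x)) ->
  (exists x, f x <> adj v (v x)) -> exists u, [/\ subiso u, extends v u & ~ extends u v].
Proof.
move=> iv [x1 ex1] [x2 fx2]; have [Av vvv ev vf] := iv.
have [bv bv' vvv' ve' fv'] := subiso_adj iv; have Av' := vN_adj vA Av.
have be := vN_bounded vA Ae; have bf := vN_bounded vA Af.
pose e0 x := e x - v (adj v x); pose f0 x := f x - adj v (v x).
have sub_lin (a b : H -> H) : A a -> A b -> A (fun x => a x - b x).
  move=> Aa Ab; have := vN_lin vA (-1) Ab Aa; congr A.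
  by apply/funext => x; rewrite scaleN1r addrC.
have Ae0 : A e0 by apply: sub_lin => //; exact: (vN_comp vA Av Av').
have Af0 : A f0 by apply: sub_lin => //; exact: (vN_comp vA Av' Av).
have be0 := vN_bounded vA Ae0; have bf0 := vN_bounded vA Af0.
have e0e0 x : e0 (e0 x) = e0 x.
  by rewrite /e0 (opB _ _ be) (opB _ _ bv') (opB _ _ bv) ee ev ve' vvv subrr subr0.
have f0f0 x : f0 (f0 x) = f0 x.
  by rewrite /f0 (opB _ _ bf) (opB _ _ bv) (opB _ _ bv') ff fv' vf vvv subrr subr0.
have [||y Ay [x3 yx3]] := @factor_connect e0 f0 Ae0 Af0.
- by exists x1 => /subr0_eq.
- by exists x2 => /subr0_eq.
have by_ := vN_bounded vA Ay.
have Ax0 : A (e0 \o (y \o f0)) by apply: (vN_comp vA) => //; exact: (vN_comp vA).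
have [D D0 xD] := bounded_norm (vN_bounded vA Ax0).
pose x0 h := (D^-1)%:C%C *: e0 (y (f0 h)).
have [|||||||w [Aw ww ew wf [x4 wx4]]] := @polar _ _ _ dot_norm A vA x0 e0 f0.
- exact: (vN_scale vA _ Ax0).
- move=> h; rewrite /x0 nm_scale ?invr_ge0 ?(ltW D0) // mul1r ler_pdivrMl //; exact: xD.
- by [].
- by [].
- by move=> h; rewrite /x0 (opZ _ _ be0) e0e0.
- by move=> h; rewrite /x0 f0f0.
- exists x3; rewrite /x0 => /eqP; rewrite scaler_eq0 => /orP[|/eqP//].
  by rewrite fmorph_eq0 invr_eq0 gt_eqF.
have bw := vN_bounded vA Aw; have bw' := bounded_adj dot_norm bw.
have www := isom_of_idem bw ww.
have vw x : adj v (w x) = 0.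
  by rewrite -ew /e0 (opB _ _ bv') ve' vvv' subrr.
have wv x : w (adj v x) = 0.
  by rewrite -wf /f0 fv' vvv' subrr (op0 bw).
have wv' x : adj w (v x) = 0.
  apply: (dot_inj (dot := dot)) => z.
  by rewrite -(adjPr dot_norm _ _ bw) (adjP dot_norm _ _ bv) vw dot0r dot0l.
have vw' x : v (adj w x) = 0.
  apply: (dot_inj (dot := dot)) => z.
  by rewrite (adjP dot_norm _ _ bv) -(adjPr dot_norm _ _ bw) wv dot0r dot0l.
pose u x := 1 *: v x + w x.
have uE x : u x = v x + w x by rewrite /u scale1r.
have uJ x : adj u x = adj v x + adj w x.
  by rewrite (adj_lin dot_norm) // rmorph1 scale1r.
have uu x : adj u (u x) = adj v (v x) + adj w (w x).
  by rewrite uJ uE (opD _ _ bv') (opD _ _ bw') vw wv' addr0 add0r.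
exists u; split.
- split; first exact: (vN_lin vA).
  + move=> x; rewrite uu !uE (opD _ _ bv) (opD _ _ bw) vvv www vw' wv addr0 add0r //.
  + move=> x; rewrite uE (opD _ _ be) ev; congr (_ + _).
    by rewrite -ew /e0 (opB _ _ be) ee ev.
  + move=> x; rewrite !uE vf; congr (_ + _).
    by rewrite -wf -[RHS]wf /f0 ff vf.
- split=> x; first by rewrite uE vvv wv addr0.
  by rewrite uu vvv wv (op0 bw') addr0.
- move=> [h _]; apply: wx4; apply: (addrI (v x4)); rewrite addr0 -uE -h.
  by rewrite uu (opD _ _ bv) vvv vw' addr0.
Qed.

Lemma maximal_subiso : exists2 v, subiso v &
  forall u, subiso u -> extends v u -> extends u v.
Proof.
have i0 : subiso (fun=> 0).
  have A0 : A (fun=> 0).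
    have := vN_scale vA 0 (vN_id vA); congr A; apply/funext => x; exact: scale0r.
  split=> // x; exact: op0 (vN_bounded vA Ae).
have [| | |v vmax] := @ZL_preorder {v | subiso v} (exist _ _ i0)
  (fun v w => `[< extends (sval v) (sval w) >]).
- by move=> v; apply/asboolP; apply: extends_refl; exact: svalP.
- by move=> v w u /asboolP vw /asboolP wu; apply/asboolP; exact: extends_trans wu.
- move=> C Ctot; have [C0|/set0P C0] := eqVneq C set0.
    by exists (exist _ _ i0) => v; rewrite C0.
  have [w [iw Cw]] := chain_bound Ctot C0.
  by exists (exist _ _ iw) => v Cv; apply/asboolP; exact: Cw.
exists (sval v); first exact: svalP.
by move=> u iu /asboolP vu; apply/asboolP; exact: (vmax (exist _ _ iu) vu).
Qed.

Lemma comparison (Tr : (H -> H) -> \bar R) : is_fns_trace dot A Tr ->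
  Tr e = 1%E -> (Tr f <= 1)%E ->
  exists2 v, subiso v & forall x, adj v (v x) = f x.
Proof.
move=> trTr Tre Trf; have [v iv vmax] := maximal_subiso; exists v => //.
have [Av vvv ev vf] := iv.
have [bv bv' vvv' ve' fv'] := subiso_adj iv; have Av' := vN_adj vA Av.
have bf := vN_bounded vA Af.
apply: contrapT => /existsNP[x2 fx2].
have ev_eq : e = v \o adj v.
  apply: contrapT => ne; have [||u [iu vu uv]] := @subiso_extend v iv.
  - by apply: contrapT => h; apply: ne; apply/funext => x; apply: contrapT => hx; apply: h;
    exists x.
  - by exists x2 => h; apply: fx2.
  - by apply: uv; exact: vmax.
pose p := adj v \o v; pose f0 x := f x - adj v (v x).
have Ap : A p by exact: (vN_comp vA).
have Af0 : A f0.
  have := vN_lin vA (-1) Ap Af; congr A; apply/funext => x /=.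
  by rewrite scaleN1r addrC.
have pos_p : pos_cone dot A p.
  split=> // x /=; rewrite dot0l -(adjPr dot_norm _ _ bv) (dotxx dot_norm) lecR; exact: sqr_ge0.
have f0f0 x : f0 (f0 x) = f0 x.
  by rewrite /f0 (opB _ _ bf) (opB _ _ bv) (opB _ _ bv') ff fv' vf vvv subrr subr0.
have f0J x y : dot (f0 x) y = dot x (f0 y).
  rewrite /f0 dotBl dotBr (adjP dot_norm _ _ bf) fJ -(adjPr dot_norm _ _ bv).
  by rewrite (adjP dot_norm _ _ bv).
have pos_f0 : pos_cone dot A f0.
  split=> // x; rewrite dot0l -f0f0 f0J (dotxx dot_norm) lecR; exact: sqr_ge0.
have fE : f = p \+ f0 by apply/funext => x; rewrite /= /f0 addrC subrK.
have Trp : Tr p = 1%E by rewrite (fns_tracial trTr Av) -ev_eq.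
have : (Tr f0 = 0)%E.
  apply/eqP; rewrite eq_le (fns_ge0 trTr) // andbT.
  by move: Trf; rewrite fE (fns_add trTr) // Trp -{2}[1%E]adde0 leeD2lE.
move/(fns_faithful trTr pos_f0) => f00; apply: fx2.
by apply/esym/subr0_eq; have := congr1 (@^~ x2) f00.
Qed.

End Comparison.

(** * The basic construction *)
Section BasicConstruction.
Context (R : realType) (H : completeNormedModType R[i]).
Context (dot : {dot H for Num.conj}).
Context (dot_norm : forall x : H, dot x x = `|x| ^+ 2).
Context (M : set (H -> H)) (tau : (H -> H) -> R[i]) (Omega : H).
Context (vM : von_neumann dot M) (tauM : is_tracial_state dot M tau).
Context (L2M : is_L2 dot M tau Omega).
Context (N : set (H -> H)) (vN : von_neumann dot N) (NM : N `<=` M).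
Context (irr : commutant N `&` M = scalars).
Local Notation adj := (adj dot).
Local Notation rdot := (real_dot dot).
Local Notation rmul := (rmul M Omega).
Local Notation orb N := [set a Omega | a in N].
Local Notation e := (jones_proj dot N Omega).
Local Notation A := (basic_construction dot M e).
Local Notation rmulE := (rmulE dot_norm vM tauM L2M).
Local Notation rmul_Omega := (rmul_Omega dot_norm vM tauM L2M).
Local Notation rmul_bounded := (rmul_bounded dot_norm vM tauM L2M).
Local Notation rmul_comm := (rmul_comm dot_norm vM tauM L2M).
Local Notation rmul_adj := (rmul_adj dot_norm vM tauM L2M).

Let oN := orb_subspace Omega vN.
Let be : bounded_op e := orth_proj_bounded dot_norm oN.
Let eJ : adj e = e := orth_proj_adj dot_norm oN.
Let ee x : e (e x) = e x := orth_proj_idem dot_norm oN x.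
Let eN x : closure (orb N) x -> e x = x := orth_proj_id dot_norm oN (x := x).
Let Ne x : closure (orb N) (e x) := (orth_projP dot_norm oN x).1.

Lemma jones_projection : projection_op dot e.
Proof. by split; [exact: be | exact: eJ | apply/funext => x; exact: ee]. Qed.

Lemma basic_sub_bounded : M `|` [set e] `<=` bounded_op.
Proof. by move=> a [Ma|->]; [exact: (vN_bounded vM) | exact: be]. Qed.

Lemma basic_vN : von_neumann dot A.
Proof. exact: (vN_generated_vN dot_norm basic_sub_bounded). Qed.

Lemma basicM a : M a -> A a.
Proof. by move=> Ma; apply: vN_generated_sub; left. Qed.

Lemma basic_e : A e.
Proof. by apply: vN_generated_sub; right. Qed.

(** The right multiplications by N form a self-adjoint set, so their commutant is a von Neumann
    algebra and only the generators are to be checked. For [e], the point is that r_n and its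
    adjoint leave N Omega invariant. *)
Lemma basic_rmul a n h : A a -> N n -> a (rmul n h) = rmul n (a h).
Proof.
pose S := [set rmul n | n in N].
have Sb : S `<=` bounded_op by move=> _ [m Nm <-]; apply: rmul_bounded; exact: NM.
have SJ s : S s -> S (adj s).
  move=> [m Nm <-]; exists (adj m); first exact: (vN_adj vN).
  by rewrite rmul_adj //; exact: NM.
suff sub : A `<=` commutant S.
  by move=> /sub/commutantP[_ aS] Nn; apply: aS; exists n.
apply: smallest_sub; first exact: (commutant_vN dot_norm).
move=> b [Mb|->]; apply/commutantP; split.
- exact: (vN_bounded vM).
- by move=> _ x [m Nm <-]; rewrite rmul_comm //; exact: NM.
- exact: be.
move=> _ x [m Nm <-]; have Mm := NM Nm; have Nm' := vN_adj vN Nm.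
apply: (orth_proj_comm dot_norm oN); first exact: rmul_bounded.
  move=> _ [d Nd <-]; apply: subset_closure; exists (d \o m); first exact: (vN_comp vN).
  by rewrite rmulE //; exact: NM.
move=> _ [d Nd <-]; apply: subset_closure; exists (d \o adj m); first exact: (vN_comp vN).
by rewrite rmul_adj // rmulE //; exact: NM.
Qed.

Lemma Omega_N : closure (orb N) Omega.
Proof. by apply: subset_closure; exists idfun => //; exact: (vN_id vN). Qed.

(** Commutation with [e] gives z Omega = z e Omega = e z Omega, which lies in the closure of N
    Omega. *)
Lemma basic_factor (z : H -> H) : A z -> commutant A z -> exists c : R[i], forall x, z x = c *: x.
Proof.
move=> Az A'z; apply: (joint_commutant_scalar dot_norm vM tauM L2M vN NM irr).
- by apply: (commutantS _ A'z) => a; exact: basicM.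
- by move=> n h Nn; exact: basic_rmul.
have -> : z Omega = e (z Omega); last exact: Ne.
by rewrite (vN_comm _ basic_e A'z) (eN Omega_N).
Qed.

Context (f : H -> H) (Af : A f) (N'f : commutant N f) (pf : projection_op dot f).

Let bf : bounded_op f. Proof. by case: pf. Qed.
Let fN n x : N n -> f (n x) = n (f x).
Proof. by move=> Nn; have /commutantP[_ ->] := N'f. Qed.

Lemma unitary_of_isometry (v : H -> H) : subiso dot A e f v ->
  (forall x, adj v (v x) = f x) -> f <> (fun=> 0) ->
  exists u : H -> H, [/\ M u, unitary_op dot u,
    forall n, N n -> N (u \o n \o adj u) & f = adj u \o e \o u].
Proof.
move=> iv vvf f0; have vA := basic_vN.
have [Av vvv ev vf] := iv.
have [bv bv' vvv' ve' fv'] := subiso_adj dot_norm vA basic_e Af jones_projection pf iv.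
have Av' := vN_adj vA Av; pose xi := adj v Omega.
have vcl x : closure (orb N) (v x) by rewrite -ev; exact: Ne.
(* The range of [v] lies in the closure of N Omega, and elements of the basic construction commute
   with r_n. So v a v^* meets the conditions of [trace_of_orb]. *)
have conj_in a : M a -> [/\ bounded_op (v \o a \o adj v),
    forall c h, N c -> (v \o a \o adj v) (rmul c h) = rmul c ((v \o a \o adj v) h)
    & closure (orb N) (adj (v \o a \o adj v) Omega)].
  move=> Ma; have ba := vN_bounded vM Ma; have Aa := basicM Ma.
  have AX : A (v \o a \o adj v) by apply: (vN_comp vA) => //; exact: (vN_comp vA).
  split; [exact: (vN_bounded vA) | by move=> c h; exact: basic_rmul |].
  rewrite (adj_comp dot_norm) //; last exact: bounded_comp.
  by rewrite (adjK dot_norm bv) /=; exact: vcl.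
(* In the products of v a v^* and v n v^* the middle factor v^* v = f moves past n and is absorbed
   by v or v^*, leaving v a n v^* and v n a v^*. *)
have xi_central a n : M a -> N n -> rdot (a (n xi)) xi = rdot (n (a xi)) xi.
  move=> Ma Nn; have Mn := NM Nn.
  have [bX Xr XO] := conj_in _ Ma; have [bY Yr YO] := conj_in _ Mn.
  have := trace_of_orb dot_norm vM tauM L2M vN NM bX bY Xr Yr (vcl _) (vcl _) XO YO.
  have f1 : f (n xi) = n (f xi) by exact: fN.
  have f2 : f (n (a xi)) = n (f (a xi)) by exact: fN.
  rewrite /= !vvf f1 -f2 fv' vf.
  by rewrite /real_dot !(adjP dot_norm _ _ bv).
have xi_state := central_vector_state dot_norm vM tauM L2M vN NM irr xi_central.
pose c := nm xi ^+ 2; have c0 : 0 <= c := sqr_ge0 _.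
have xi_nm a : M a -> nm (a xi) = nm xi * nm (a Omega).
  move=> Ma; have Ma' := vN_adj vM Ma; have ba := vN_bounded vM Ma.
  apply/eqP; rewrite -(@eqrXn2 _ 2) ?mulr_ge0 ?nm_ge0 // exprMn.
  have aa z : rdot ((adj a \o a) z) z = nm (a z) ^+ 2.
    by rewrite /real_dot /= -(adjPr dot_norm _ _ ba) -(rdotxx dot_norm).
  by rewrite -!aa (xi_state _ (vN_comp vM Ma' Ma)).
(* By [xi_nm], the map a Omega |-> a xi is bounded. It commutes with M, so [left_of_commutant] turns
   [xi] into L Omega with L in M. *)
have [w [M'w wO]] : exists w, commutant M w /\ w Omega = xi.
  have [|||T [bT _ TG _]] := @bounded_extension _ _ _ dot_norm
    (fun x y => exists a, [/\ M a, x = a Omega & y = a xi]) (nm xi) (nm_ge0 xi).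
  - exists (fun x => 0 *: idfun x); split; rewrite ?scale0r //.
    by apply: (vN_scale vM); exact: (vN_id vM).
  - move=> k _ _ _ _ [a [Ma -> ->]] [b [Mb -> ->]].
    by exists (fun x => k *: a x + b x); split=> //; exact: (vN_lin vM).
  - by move=> _ _ [a [Ma -> ->]]; rewrite xi_nm.
  exists T; split; last by apply: TG; exists idfun; split=> //; exact: (vN_id vM).
  apply/commutantP; split=> // s x Ms; have bs := vN_bounded vM Ms.
  apply: (dense_op dot_norm vM L2M (S := T \o s) (T := s \o T));
    [exact: bounded_comp | exact: bounded_comp |].
  move=> a Ma /=; rewrite (TG (s (a Omega)) (s (a xi))).
    by rewrite (TG (a Omega) (a xi)) //; exists a.
  by exists (s \o a); split=> //; exact: (vN_comp vM).
have [L ML LO] := left_of_commutant dot_norm vM tauM L2M M'w; rewrite wO in LO.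
have bL := vN_bounded vM ML; have ML' := vN_adj vM ML; have bL' := vN_bounded vM ML'.
have O1 : rdot Omega Omega = 1 by rewrite /real_dot (dotOmega vM tauM L2M).
have scal_eq (S : H -> H) : M S -> S Omega = c%:C%C *: Omega -> forall x, S x = c%:C%C *: x.
  move=> MS SO x; suff -> : S = fun x => c%:C%C *: idfun x by [].
  apply: (orb_inj dot_norm vM tauM L2M) => //.
  by apply: (vN_scale vM); exact: (vN_id vM).
(* Moving L across by the trace property, the state formula says <L L^* Omega, a Omega> = c <Omega,
   a Omega> in real parts, for all a in M. *)
have LL' : forall x, L (adj L x) = c%:C%C *: x.
  apply: (scal_eq (L \o adj L)); first exact: (vN_comp vM).
  apply/subr0_eq/(dense_eq0 dot_norm L2M) => a Ma; have Ma' := vN_adj vM Ma.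
  have ba := vN_bounded vM Ma.
  have e1 := xi_state _ Ma'; rewrite -LO in e1.
  have : rdot (adj a (L Omega)) (L Omega) = rdot (L (adj L Omega)) (a Omega).
    have MaL : M (adj a \o L) by exact: (vN_comp vM).
    rewrite /real_dot -[adj a (L Omega)]/((adj a \o L) Omega).
    rewrite -(dot_adj_orb dot_norm vM tauM L2M ML MaL) (adj_comp dot_norm) //;
      last exact: (vN_bounded vM).
    by rewrite /= (adjK dot_norm ba) (adjP dot_norm _ _ bL).
  rewrite rdotE rdotNl rdotZl => <-; rewrite e1 -/c LO.
  have -> : rdot (adj a Omega) Omega = rdot Omega (a Omega).
    by rewrite /real_dot (adjPr dot_norm _ _ ba).
  by rewrite subrr.
have xi2 : nm (L Omega) ^+ 2 = c by rewrite LO.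
(* Here <L^* L Omega, Omega> = |L Omega|^2 = c, and L L^* = c gives |L^* L Omega|^2 = c^2. Hence
   |L^* L Omega - c Omega|^2 = c^2 - 2 c^2 + c^2 = 0. *)
have L'L : forall x, adj L (L x) = c%:C%C *: x.
  apply: (scal_eq (adj L \o L)); first exact: (vN_comp vM).
  apply/subr0_eq/nm_eq0/eqP; rewrite -sqrf_eq0 -(rdotxx dot_norm) /= !rdotE O1.
  have r1 : rdot (adj L (L Omega)) Omega = c.
    by rewrite /real_dot -(adjPr dot_norm _ _ bL) -(rdotxx dot_norm) in xi2 *.
  have r2 : rdot (adj L (L Omega)) (adj L (L Omega)) = c ^+ 2.
    rewrite /real_dot -(adjPr dot_norm _ _ bL) LL' -/(rdot _ _) rdotZr (rdotxx dot_norm) xi2.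
    by rewrite expr2.
  by rewrite (rdotC dot Omega) r1 r2; apply/eqP; ring.
(* Both v^* and L agree at Omega and commute with r_n, so they agree on N Omega and on its closure;
   precomposing with [e] extends this to all vectors. *)
have v'E h : adj v h = L (e h).
  rewrite -ve'; apply/subr0_eq.
  apply: (vanish_closure (a := fun h => adj v h - L h) (D := orb N)) => //.
  - have := bounded_lin (-1) bL bv'; congr bounded_op.
    by apply/funext => x; rewrite scaleN1r addrC.
  - move=> _ [n Nn <-]; have Mn := NM Nn.
    by rewrite -(rmul_Omega Mn) (basic_rmul _ Av' Nn) -/xi -LO -rmul_comm // subrr.
have vE h : v h = e (adj L h).
  apply: (dot_inj (dot := dot)) => z.
  rewrite (adjP dot_norm _ _ bv) v'E (adjP dot_norm _ _ be) eJ.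
  by rewrite -(adjPr dot_norm _ _ bL).
have fE h : f h = L (e (adj L h)) by rewrite -vvf vE v'E ee.
(* The square of L e L^* is c L e L^*, whereas f is a non-zero idempotent. *)
have c1 : c = 1.
  have /existsNP[x fx] : ~ forall x, f x = 0.
    by move=> h; apply: f0; apply/funext.
  have /eqP : (c%:C%C - 1) *: f x = 0.
    rewrite scalerBl scale1r; apply/eqP; rewrite subr_eq0; apply/eqP.
    have ff : f (f x) = f x by case: pf => _ _ /(congr1 (@^~ x)).
    rewrite -[RHS]ff [f (f x)]fE [in RHS]fE L'L (opZ _ _ be) (opZ _ _ bL) ee -fE //.
  rewrite scaler_eq0 => /orP[|/eqP//]; rewrite subr_eq0 => /eqP h.
  exact: (congr1 (@complex.Re R) h).
have LL1 x : L (adj L x) = x by rewrite LL' c1 scale1r.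
have L1L x : adj L (L x) = x by rewrite L'L c1 scale1r.
exists (adj L); rewrite (adjK dot_norm bL); split=> //.
- by split; [exact: bL' | |]; rewrite (adjK dot_norm bL); apply/funext => x /=.
- move=> n Nn; have Mn := NM Nn; have An := basicM Mn; have bn := vN_bounded vM Mn.
  have MT : M (adj L \o n \o L) by apply: (vN_comp vM) => //; exact: (vN_comp vM).
  apply: (mem_of_orb dot_norm vM tauM L2M vN NM (vN_bounded vM MT)).
    by move=> d h Md; rewrite rmul_comm.
  (* Applying L^* to f n L Omega = n f L Omega, with f = L e L^*, shows that [e] fixes L^* n L
     Omega. This vector therefore lies in the closure of N Omega, as [mem_of_orb] requires. *)
  suff -> : (adj L \o n \o L) Omega = e ((adj L \o n \o L) Omega) by exact: Ne.
  have fn : f (n (L Omega)) = n (f (L Omega)) by exact: fN.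
  have := congr1 (adj L) fn; rewrite !fE !L1L /= (eN Omega_N) => ->.
  by [].
- by apply/funext => x; rewrite fE.
Qed.

End BasicConstruction.

Theorem theorem3p4 (R : realType) (H : completeNormedModType R[i])
    (dot : {dot H for Num.conj}) (dot_norm : forall x : H, dot x x = `|x| ^+ 2)
    (M N : set (H -> H)) (tau : (H -> H) -> R[i]) (Omega : H)
    (Tr : (H -> H) -> \bar R) :
  is_II1_factor dot M ->
  is_II1_factor dot N ->
  N `<=` M ->
  commutant N `&` M = scalars ->
  is_tracial_state dot M tau ->
  is_L2 dot M tau Omega ->
  let eN := jones_proj dot N Omega in
  let MeN := basic_construction dot M eN in
  is_fns_trace dot MeN Tr ->
  Tr eN = 1%E ->
  (forall f : H -> H,
     (commutant N `&` MeN) f -> projection_op dot f -> f <> (fun=> 0) ->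
     (Tr f <= 1)%E ->
     exists u : H -> H,
       [/\ M u, unitary_op dot u,
           forall n, N n -> N (u \o n \o adj dot u) &
           f = adj dot u \o eN \o u]) /\
  (forall f : H -> H,
     (commutant N `&` MeN) f -> projection_op dot f -> f <> (fun=> 0) ->
     (1 <= Tr f)%E).
Proof.
move=> [[vM _] _ _] [[vN _] _ _] NM irr tauM L2M eN MeN trTr TreN.
have vA : von_neumann dot MeN by exact: basic_vN.
have AeN : MeN eN by exact: basic_e.
have peN : projection_op dot eN by exact: jones_projection.
have part1 f : (commutant N `&` MeN) f -> projection_op dot f -> f <> (fun=> 0) ->
    (Tr f <= 1)%E -> exists u : H -> H, [/\ M u, unitary_op dot u,
      forall n, N n -> N (u \o n \o adj dot u) & f = adj dot u \o eN \o u].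
  move=> [N'f Af] pf f0 Trf.
  have factorA := basic_factor dot_norm vM tauM L2M vN NM irr.
  have [v iv vvf] := comparison dot_norm vA factorA AeN Af peN pf trTr TreN Trf.
  exact: (unitary_of_isometry dot_norm vM tauM L2M vN NM irr Af N'f pf iv vvf f0).
split=> // f N'f pf f0; rewrite leNgt; apply/negP => Trf.
have [u [Mu [bu uu uu'] _ fE]] := part1 f N'f pf f0 (ltW Trf).
have [be eJ ee] := peN.
have Au : MeN u by exact: basicM.
suff Tr1 : Tr f = 1%E by rewrite Tr1 ltxx in Trf.
(* For eN u the two sides of the tracial identity are u^* eN u = f and eN u u^* eN = eN. *)
have := fns_tracial trTr (vN_comp vA AeN Au).
rewrite (adj_comp dot_norm be bu) eJ.
have -> : (adj dot u \o eN) \o (eN \o u) = f.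
  by rewrite fE; apply/funext => x /=; have /= := congr1 (@^~ (u x)) ee => ->.
move=> ->; have -> : (eN \o u) \o (adj dot u \o eN) = eN; last by [].
apply/funext => x /=; have /= := congr1 (@^~ (eN x)) uu' => ->.
exact: (congr1 (@^~ x) ee).
Qed.
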